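(* For every chordal graph $G$, the Feichtner--Yuzvinsky algebra $\mathrm{FY}(\mathcal{L}_G,\mathcal{G}_G)$ admits a quadratic Gröbner basis.
   Context: Graphs are finite and simple. A graph is chordal if every cycle (of length at least 4) has a chord. For a graph $G=(V,E)$, $\mathcal{L}_G$ is the lattice of flats of the graphical matroid of $G$ (a geometric lattice whose atoms are the edges of $G$), and $\mathcal{G}_G$ is the building set of $\mathcal{L}_G$ consisting of the non-empty flats which, viewed as sets of edges, are connected. For a geometric lattice $\mathcal{L}$ with least element $\hat 0$, a building set is a subset $\mathcal{G}\subset\mathcal{L}\setminus\{\hat 0\}$ such that for every $X\in\mathcal{L}$ the join map $\prod_{F\in\max\mathcal{G}_{\le X}}[\hat 0,F]\to[\hat 0,X]$ is an isomorphism of posets, where $\max\mathcal{G}_{\le X}$ is the set of maximal elements of $\mathcal{G}\cap[\hat 0,X]$. The Feichtner--Yuzvinsky ring is the graded commutative ring $\mathrm{FY}(\mathcal{L},\mathcal{G})=\mathbb{Z}[h_F,\ F\in\mathcal{G}]/\mathcal{I}_{\mathrm{wond}}$, where $\mathcal{I}_{\mathrm{wond}}$ is generated by $h_H$ for every atom $H$ and by $\prod_{F'\in\mathcal{A}}(h_F-h_{F'})$ for every $F\in\mathcal{G}$ and every antichain $\mathcal{A}$ in $\mathcal{G}$ with $\bigvee\mathcal{A}=F$. Each $h_F$ has weight 1 (cohomological degree 2). An algebra admits a quadratic Gröbner basis if it can be presented as the quotient of a polynomial ring on generators of weight 1 by a homogeneous ideal which, for some monomial order, has a Gröbner basis consisting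 of homogeneous elements of weight 2; over $\mathbb{Z}$ a Gröbner basis is understood with leading coefficients $\pm1$. (Here, the generators $h_H$ with $H$ an atom, which are zero, are discarded.) *)

(* Defs.v *)
From HB Require Import structures.
From mathcomp Require Import all_boot all_order all_algebra.
From mathcomp Require Import boolp.
From mathcomp Require Import mpoly.

Set Implicit Arguments.
Unset Strict Implicit.
Unset Printing Implicit Defensive.

Import Order.TTheory GRing.Theory.
Local Open Scope quotient_scope.
Local Open Scope ring_scope.

(** * Matroids and their lattices of flats *)

Record matroid (T : finType) := Matroid {
  ground : {set T};
  indep : {set {set T}};
  indep_ground : forall A : {set T}, A \in indep -> A \subset ground;
  indep_set0 : set0 \in indep;
  indep_subset : forall A B : {set T}, A \subset B -> B \in indep -> A \in indep;
  indep_augment : forall A B : {set T}, A \in indep -> B \in indep -> (#|A| < #|B|)%N ->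
    exists2 x, x \in B :\: A & x |: A \in indep }.

Section Flats.
Variables (T : finType) (M : matroid T).
Implicit Types (A B F : {set T}).

Definition rank A : nat := (\max_(B in indep M | B \subset A) #|B|)%N.

Definition is_flat F : bool :=
  (F \subset ground M) &&
  [forall x in ground M :\: F, (rank F < rank (x |: F))%N].

Lemma leq_rank A B : B \in indep M -> B \subset A -> (#|B| <= rank A)%N.
Proof.
by move=> iB sBA; apply: (bigop.bigmax_sup B); rewrite ?iB.
Qed.

Lemma rank_basis A :
  exists2 B, (B \in indep M) && (B \subset A) & rank A = #|B|.
Proof.
rewrite /rank.
case: (@bigop.eq_bigmax_cond _ [pred B | (B \in indep M) && (B \subset A)]
         (fun B : {set T} => #|B|)).
  by apply/card_gt0P; exists set0; rewrite inE indep_set0 sub0set.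
by move=> B PB eqB; exists B.
Qed.

Lemma basis_extend A B : B \in indep M -> B \subset A ->
  exists2 C, [&& C \in indep M, B \subset C & C \subset A] & rank A = #|C|.
Proof.
move=> iB sBA.
pose P C := [&& C \in indep M, B \subset C & C \subset A].
have PB : P B by rewrite /P iB subxx.
case: (arg_maxnP (fun C : {set T} => #|C|) PB) => C PC maxC.
exists C => //; apply/eqP; rewrite eqn_leq.
case/and3P: (PC) => iC sBC sCA.
rewrite (leq_rank iC sCA) andbT leqNgt; apply/negP => ltC.
have [D /andP[iD sDA] eD] := rank_basis A.
rewrite eD in ltC.
have [x /setDP[xD xC] ixC] := indep_augment iC iD ltC.
have := maxC (x |: C).
rewrite /P ixC (subset_trans sBC (subsetUr _ _)) subUset sub1set.
rewrite (subsetP sDA _ xD) sCA => /(_ isT).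
by rewrite /= cardsU1 xC add1n ltnn.
Qed.

Lemma is_flat_ground : is_flat (ground M).
Proof.
by rewrite /is_flat subxx; apply/forall_inP => x; rewrite setDv inE.
Qed.

Lemma is_flatI F1 F2 : is_flat F1 -> is_flat F2 -> is_flat (F1 :&: F2).
Proof.
move=> fl1 fl2; rewrite /is_flat.
case/andP: (fl1) => s1 _; rewrite (subset_trans (subsetIl _ _) s1) /=.
apply/forall_inP => x /setDP[xg].
wlog xF1 : F1 F2 fl1 fl2 s1 / x \notin F1 => [IH|_].
  rewrite inE negb_and => /orP[xF|xF].
    by apply: (IH F1 F2) => //; rewrite inE negb_and xF.
  by rewrite setIC; apply: (IH F2 F1) => //; rewrite ?inE ?negb_and ?xF //;
    case/andP: fl2.
have [B /andP[iB sB] ->] := rank_basis (F1 :&: F2).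
have sB1 : B \subset F1 := subset_trans sB (subsetIl _ _).
have [C /and3P[iC sBC sC] eC] := basis_extend iB sB1.
case/andP: fl1 => _ /forall_inP/(_ x); rewrite inE xF1 xg => /(_ isT).
have [D /andP[iD sD] ->] := rank_basis (x |: F1).
rewrite eC => ltCD; have [y /setDP[yD yC] iy] := indep_augment iC iD ltCD.
have yx : y = x.
  have := subsetP sD _ yD; rewrite in_setU1 => /predU1P[//|yF].
  have := leq_rank iy (_ : y |: C \subset F1).
  by rewrite subUset sub1set yF sC eC cardsU1 yC add1n ltnn => /(_ isT).
rewrite {}yx in yC iy.
have xB : x \notin B by apply: contra xF1; apply: (subsetP sB1).
have <- : #|x |: B| = #|B|.+1 by rewrite cardsU1 xB add1n.
apply: leq_rank; last exact: setUS.
by apply: indep_subset iy; apply: setUS.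
Qed.

Definition flat_closure A : {set T} :=
  ground M :&: \bigcap_(F | is_flat F && (A \subset F)) F.

Lemma flat_closure_flat A : is_flat (flat_closure A).
Proof.
rewrite /flat_closure; elim/big_ind: _ => [|F1 F2 h1 h2|F /andP[fF _]].
- by rewrite setIT is_flat_ground.
- by rewrite setIIr; apply: is_flatI.
- by apply: is_flatI => //; apply: is_flat_ground.
Qed.

Lemma flat_closure_min A F : is_flat F -> A \subset F -> flat_closure A \subset F.
Proof.
move=> fF sA; apply: subset_trans (subsetIr _ _) _.
by apply: bigcap_inf; rewrite fF.
Qed.

Lemma sub_flat_closure A : A \subset ground M -> A \subset flat_closure A.
Proof.
by move=> sA; rewrite subsetI sA; apply/bigcapsP => F /andP[].
Qed.

Record flat := Flat { flat_set :> {set T}; flatP : is_flat flat_set }.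

HB.instance Definition _ := [isSub for flat_set].
HB.instance Definition _ := [Finite of flat by <:].

Lemma flat_ground (F : flat) : F \subset ground M.
Proof. by case: F => F /= /andP[]. Qed.

Definition flat_le (F1 F2 : flat) : bool := F1 \subset F2.
Definition flat_meet (F1 F2 : flat) : flat := Flat (is_flatI (flatP F1) (flatP F2)).
Definition flat_join (F1 F2 : flat) : flat := Flat (flat_closure_flat (F1 :|: F2)).
Definition flat_bot : flat := Flat (flat_closure_flat set0).
Definition flat_top : flat := Flat is_flat_ground.

Fact flat_display : Order.disp_t. Proof. exact: Order.Disp tt tt. Qed.

Lemma flat_le_refl : reflexive flat_le.
Proof. by move=> F; apply: subxx. Qed.

Lemma flat_le_anti : antisymmetric flat_le.
Proof.
by move=> F1 F2 /andP[s12 s21]; apply/val_inj/eqP; rewrite eqEsubset; apply/andP.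
Qed.

Lemma flat_le_trans : transitive flat_le.
Proof. by move=> F2 F1 F3; apply: subset_trans. Qed.

HB.instance Definition _ := Order.Le_isPOrder.Build flat_display flat
  flat_le_refl flat_le_anti flat_le_trans.

Lemma flat_leE (F1 F2 : flat) : (F1 <= F2)%O = (F1 \subset F2).
Proof. by []. Qed.

Lemma flat_lexI (F1 F2 F3 : flat) :
  (F1 <= flat_meet F2 F3)%O = (F1 <= F2)%O && (F1 <= F3)%O.
Proof. by rewrite !flat_leE /= subsetI. Qed.

Lemma flat_leUx (F1 F2 F3 : flat) :
  (flat_join F1 F2 <= F3)%O = (F1 <= F3)%O && (F2 <= F3)%O.
Proof.
rewrite !flat_leE -subUset; apply/idP/idP => [|s]; last first.
  by apply: flat_closure_min => //; apply: flatP.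
by apply: subset_trans; apply: sub_flat_closure; rewrite subUset !flat_ground.
Qed.

HB.instance Definition _ := Order.POrder_MeetJoin_isLattice.Build
  flat_display flat flat_lexI flat_leUx.

Lemma flat_le0x (F : flat) : (flat_bot <= F)%O.
Proof. by rewrite flat_leE flat_closure_min ?flatP ?sub0set. Qed.

Lemma flat_lex1 (F : flat) : (F <= flat_top)%O.
Proof. exact: flat_ground. Qed.

HB.instance Definition _ := Order.hasBottom.Build flat_display flat flat_le0x.
HB.instance Definition _ := Order.hasTop.Build flat_display flat flat_lex1.

End Flats.

(** * Building sets *)

Section BuildingSets.
Context {d : Order.disp_t} {L : finTBLatticeType d}.
Implicit Types (G : {set L}) (X Y F : L).

Definition max_below G X : {set L} :=
  [set F in G | (F <= X)%O &&
    [forall F' in G, (F <= F')%O && (F' <= X)%O ==> (F' == F)]].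

(* An element of the product of the intervals [0, F], for F in
   max_below G X, is a function on L with f F <= F for F in max_below G X and
   f F = 0 for all other F. *)
Definition max_below_prod G X : {pred {ffun L -> L}} :=
  pfamily \bot%O (mem (max_below G X)) (fun F => [pred Y | (Y <= F)%O]).

Definition join_map G X (f : {ffun L -> L}) : L :=
  (\join_(F in max_below G X) f F)%O.

Definition is_building_set G : Prop :=
  \bot%O \notin G /\
  forall X,
    [/\ {in max_below_prod G X, forall f, (join_map G X f <= X)%O},
        {in max_below_prod G X &, forall f g,
          (join_map G X f <= join_map G X g)%O = [forall F, (f F <= g F)%O]}
      & forall Y, (Y <= X)%O ->
          exists2 f, f \in max_below_prod G X & join_map G X f = Y].

Definition is_atom X : bool :=
  (\bot < X)%O && [forall Y, (\bot < Y <= X)%O ==> (Y == X)].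

End BuildingSets.

Record building_set {d : Order.disp_t} (L : finTBLatticeType d) := BuildingSet {
  bset :> {set L};
  building_setP : is_building_set bset }.

(** * Ideals given by generators *)

Section IdealSpan.
Variable R : comNzRingType.

Definition in_ideal_span (S : R -> Prop) (p : R) : Prop :=
  exists2 s : seq (R * R), {in s, forall x, S x.2}
                         & p = \sum_(x <- s) x.1 * x.2.

Definition ideal_span (S : R -> Prop) : {pred R} :=
  fun p => `[< in_ideal_span S p >].

Lemma ideal_spanP (S : R -> Prop) p :
  reflect (in_ideal_span S p) (p \in ideal_span S).
Proof. exact: asboolP. Qed.

Lemma ideal_span_gen (S : R -> Prop) p : S p -> p \in ideal_span S.
Proof.
move=> Sp; apply/ideal_spanP; exists [:: (1, p)].
  by move=> x; rewrite inE => /eqP->.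
by rewrite big_seq1 mul1r.
Qed.

Lemma ideal_span_min (S : R -> Prop) (I : {pred R}) :
  (forall p, S p -> p \in I) -> 0 \in I ->
  {in I &, forall p q, p + q \in I} -> (forall a p, p \in I -> a * p \in I) ->
  {subset ideal_span S <= I}.
Proof.
move=> IS I0 ID IM p /ideal_spanP[s sS ->]; rewrite big_seq.
by elim/big_ind: _ => // x /sS/IS; apply: IM.
Qed.

Lemma ideal_span_idealr (S : R -> Prop) :
  1 \notin ideal_span S -> idealr_closed (ideal_span S).
Proof.
move=> I1; split=> // [|a p q].
  by apply/ideal_spanP; exists [::]; rewrite ?big_nil.
case/ideal_spanP=> s sS -> /ideal_spanP[t tS ->]; apply/ideal_spanP.
exists ([seq (a * x.1, x.2) | x <- s] ++ t).
  by move=> x; rewrite mem_cat => /orP[/mapP[y /sS yS ->]|/tS].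
rewrite big_cat big_map mulr_sumr; congr (_ + _).
by apply: eq_bigr => x _; rewrite /= mulrA.
Qed.

End IdealSpan.

(** * The Feichtner--Yuzvinsky ring *)

Section FYRing.
Context {d : Order.disp_t} {L : finTBLatticeType d} (G : building_set L).

(* The variable 'X_i is h_F for F = enum_val i, so that sets of indices stand
   for subsets of G. *)
Definition FY_poly := {mpoly int[#|G|]}.

Definition is_antichain (A : {set 'I_#|G|}) : bool :=
  [forall i in A, forall j in A, (enum_val i <= enum_val j)%O ==> (i == j)].

Inductive FY_relation : FY_poly -> Prop :=
| FY_atom (i : 'I_#|G|) of is_atom (enum_val i) : FY_relation 'X_i
| FY_antichain (i : 'I_#|G|) (A : {set 'I_#|G|}) of
    is_antichain A & (\join_(j in A) enum_val j)%O = enum_val i :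
    FY_relation (\prod_(j in A) ('X_i - 'X_j)).

Definition FY_ideal : {pred FY_poly} := ideal_span FY_relation.

Lemma FY_relation_coef0 p : FY_relation p -> p@_0%MM = 0.
Proof.
have X0 (i : 'I_#|G|) : ('X_i : FY_poly)@_0%MM = 0.
  by rewrite mcoeffX mnm1_eq0.
case=> [i _|i A _ joinA]; first exact: X0.
have /set0Pn[j jA] : A != set0.
  apply/eqP=> A0; have [+ _] := building_setP G.
  by have := enum_valP i; rewrite -joinA A0 big_set0 => ->.
rewrite (bigD1 j) //= (rmorphM (mcoeff 0%MM)) /=.
by rewrite mcoeffB !X0 subrr mul0r.
Qed.

Lemma FY_ideal_proper : 1 \notin FY_ideal.
Proof.
have sub0 : {subset FY_ideal <= [pred p : FY_poly | p@_0%MM == 0]}.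
  apply: ideal_span_min => [p /FY_relation_coef0 p0||p q|a p]; rewrite !inE.
  - by rewrite p0.
  - by rewrite mcoeff0.
  - by move=> /eqP p0 /eqP q0; rewrite mcoeffD p0 q0.
  - by move=> /eqP p0; rewrite (rmorphM (mcoeff 0%MM)) /= p0 mulr0.
by apply/negP=> /sub0; rewrite inE mcoeff1 eqxx.
Qed.

HB.instance Definition _ := isIdealr.Build FY_poly FY_ideal
  (ideal_span_idealr FY_ideal_proper).

Definition FY := {ideal_quot FY_ideal}.

Definition FY_weight (k : nat) (x : FY) : Prop :=
  exists2 p : FY_poly, p \is k.-homog & x = \pi_FY p.

End FYRing.

(** * Quadratic Groebner bases over the integers *)

Section Groebner.
Context {n : nat}.
Implicit Types (le : rel 'X_{1..n}) (p q : {mpoly int[n]}).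

(* A total order compatible with products and with least element 1 is
   automatically a well-order (Dickson's lemma). *)
Definition monomial_order le : Prop :=
  [/\ total le, antisymmetric le, transitive le,
      forall m, le 0%MM m
    & forall m m1 m2, le m1 m2 -> le (m + m1)%MM (m + m2)%MM].

Definition lead_mon le p : 'X_{1..n} := last 0%MM (sort le (msupp p)).
Definition lead_coeff le p : int := p@_(lead_mon le p).
Definition lead_term le p : {mpoly int[n]} := lead_coeff le p *: 'X_[lead_mon le p].

Definition is_groebner_basis le (I : {pred {mpoly int[n]}})
    (B : seq {mpoly int[n]}) : Prop :=
  [/\ {subset B <= I},
      {in B, forall g, lead_coeff le g \in [:: 1; -1]}
    & {in I, forall p,
        lead_term le p \in ideal_span (fun t => exists2 g, g \in B & t = lead_term le g)}].

Definition is_homogeneous_ideal (I : {pred {mpoly int[n]}}) : Prop :=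
  {in I, forall p k, pihomog mdeg k p \in I}.

End Groebner.

(* weight k x means that x is homogeneous of weight k.  R is presented as the
   quotient of Z[x_1, .., x_n] by the kernel I of phi. *)
Definition admits_quadratic_GB (R : comNzRingType) (weight : nat -> R -> Prop) : Prop :=
  exists (n : nat) (phi : {rmorphism {mpoly int[n]} -> R}),
    let I : {pred {mpoly int[n]}} := fun p => phi p == 0 in
    [/\ forall i, weight 1%N (phi 'X_i),
        forall x, exists p, phi p = x,
        is_homogeneous_ideal I
      & exists (le : rel 'X_{1..n}) (B : seq {mpoly int[n]}),
          [/\ monomial_order le, is_groebner_basis le I B
            & {in B, forall g, g \is 2.-homog}]].

(** * Graphs and graphical matroids *)

Record sgraph := SGraph {
  vertex :> finType;
  adj : rel vertex;
  adj_sym : ssrbool.symmetric adj;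
  adj_irrefl : irreflexive adj }.

Definition chordal (G : sgraph) : Prop :=
  forall c : seq G, (4 <= size c)%N -> ucycle (@adj G) c ->
    exists x y, [/\ x \in c, y \in c, adj x y, y != next c x & x != next c y].

Section EdgeSets.
Variable V : finType.
Implicit Types (A B J : {set {set V}}) (x y u v : V).

Definition link A : rel V := fun x y => [set x; y] \in A.

(* A closed simple walk of length at most 2 is not a cycle. *)
Definition acyclic A : bool :=
  `[< forall c : seq V, ucycle (link A) c -> (size c <= 2)%N >].

Lemma link_sym A : ssrbool.symmetric (link A).
Proof. by move=> x y; rewrite /link setUC. Qed.

Lemma connect_link_sym A : connect_sym (link A).
Proof. exact/sym_connect_sym/link_sym. Qed.

Lemma sub_link A B : A \subset B -> subrel (link A) (link B).
Proof. by move=> sAB x y; apply: (subsetP sAB). Qed.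

Lemma sub_connect_link A B : A \subset B ->
  subrel (connect (link A)) (connect (link B)).
Proof.
by move=> sAB; apply: connect_sub => x y /(sub_link sAB); apply: connect1.
Qed.

Lemma set2_eq x y u v :
  [set x; y] = [set u; v] -> x = u /\ y = v \/ x = v /\ y = u.
Proof.
move=> e; have := set22 u v; have := set21 u v.
have := set22 x y; have := set21 x y.
rewrite {1 2}e -{3 4}e !in_set2.
move=> /orP[]/eqP h1 /orP[]/eqP h2 /orP[]/eqP h3 /orP[]/eqP h4;
  by (left; split; congruence) || (right; split; congruence).
Qed.

Lemma acyclicW A B : A \subset B -> acyclic B -> acyclic A.
Proof.
move=> sAB /asboolP acB; apply/asboolP => c /andP[cc uc]; apply: acB.
by rewrite /ucycle uc andbT; apply: sub_cycle cc; apply: sub_link.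
Qed.

Lemma acyclic_cut A x y : acyclic A -> x != y -> link A x y ->
  ~~ connect (link (A :\ [set x; y])) x y.
Proof.
move=> /asboolP acA nxy Axy; apply/negP => /connectP[p pth yE].
case/shortenP: pth yE => p' pth' up' _ lE.
have := acA (x :: p'); rewrite /ucycle up' andbT /= rcons_path -lE.
rewrite (sub_path (sub_link (subsetDl _ _)) pth') link_sym Axy => /(_ isT).
case: p' lE pth' {up'} => [/= e|z [/= e|//]]; first by rewrite e eqxx in nxy.
by rewrite e /link !inE eqxx.
Qed.

Lemma acyclicU A x y : acyclic A -> ~~ connect (link A) x y ->
  acyclic ([set x; y] |: A).
Proof.
move=> acA nxy; apply/asboolP => c /andP[cc uc]; rewrite leqNgt; apply/negP => sz.
case: (boolP (cycle (link A) c)) => [cA|ncA].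
  by move/asboolP: acA => /(_ c); rewrite /ucycle cA uc leqNgt sz => /(_ isT).
have [u cu nu] : exists2 u, u \in c & ~~ link A u (next c u).
  apply/hasP; rewrite -[has _ _]negbK -all_predC; apply: contra ncA => /allP h.
  by apply: (cycle_from_next uc) => z /h; rewrite /= negbK.
have [i p def_p] := rot_to cu.
rewrite -(next_rot i uc) def_p in nu.
rewrite -(rot_cycle i) def_p in cc; rewrite -(rot_uniq i) def_p in uc.
rewrite -(size_rot i) def_p in sz; move: cc uc sz nu; case: p {def_p} => [//|w [//|z q]].
set q' := z :: q => cc uq _; rewrite [next _ _]/= eqxx => nuw.
have uw : [set u; w] = [set x; y].
  case/andP: cc => + _; rewrite /link in_setU1 => /orP[/eqP//|].
  by rewrite -/(link A u w) (negbTE nuw).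
have inA t t' : link ([set x; y] |: A) t t' -> [set t; t'] != [set u; w] -> link A t t'.
  by rewrite /link in_setU1 -uw => /orP[->|].
have /andP[nuq /andP[nwq _]] : (u \notin w :: q') && uniq (w :: q') := uq.
have /andP[pth lu] : path (link ([set x; y] |: A)) w q' &&
    link ([set x; y] |: A) (last w q') u by rewrite -rcons_path; case/andP: cc.
have cwt : connect (link A) w (last w q').
  apply/connectP; exists q' => //.
  apply: (@sub_in_path _ (predC1 u) (link ([set x; y] |: A))) pth => [a b|].
    rewrite !inE => au bu lab; apply: inA => //; apply: contraTneq (set21 u w) => <-.
    by rewrite !inE negb_or ![u == _]eq_sym au.
  by apply/allP => a aq; apply: contraNneq nuq => <-.
have ltu : link A (last w q') u.
  apply: inA lu _; apply: contraTneq (set22 u w) => <-.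
  rewrite !inE negb_or; apply/andP; split.
    by apply: contraNneq nwq => ->; rewrite /= mem_last.
  by apply: contraNneq nuq => ->; rewrite mem_head.
have cwu : connect (link A) w u := connect_trans cwt (connect1 ltu).
case/set2_eq: uw => -[eu ew]; move: nxy; rewrite -eu -ew ?cwu //.
by rewrite connect_link_sym cwu.
Qed.

Lemma connect_exit (R : rel V) (P : pred V) x y :
  connect R x y -> P x -> ~~ P y -> exists u v, [/\ R u v, P u & ~~ P v].
Proof.
case/connectP=> p; elim: p x => [|z p IH] x /=; first by move=> _ -> ->.
case/andP=> Rxz pth yE Px nPy; case: (boolP (P z)) => [Pz|nPz]; first exact: IH pth yE Pz nPy.
by exists x, z.
Qed.

Lemma acyclic_span_card A J : acyclic J -> {in J, forall e : {set V}, #|e| = 2%N} ->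
  (forall x y, link J x y -> connect (link A) x y) -> (#|J| <= #|A|)%N.
Proof.
have [k] := ubnP #|J :\: A|; elim: k J => // k IH J; rewrite ltnS => leJ acJ J2 spJ.
have [JA0|/set0Pn[e /setDP[eJ nAe]]] := eqVneq (J :\: A) set0.
  by apply: subset_leq_card; rewrite -setD_eq0 JA0.
have /eqP/cards2P[x [y [nxy eE]]] := J2 _ eJ.
have Jxy : link J x y by rewrite /link -eE.
have ncut := acyclic_cut acJ nxy Jxy.
have [u [v [Auv xu nxv]]] := connect_exit (spJ _ _ Jxy) (connect0 _ x) ncut.
have nuv : u != v by apply: contraNneq nxv => <-.
have nJuv : [set u; v] \notin J.
  apply: contra nxv => Juv; apply: connect_trans xu (connect1 _).
  by rewrite /link in_setD1 Juv andbT -eE; apply: contraNneq nAe => <-.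
have ac' : acyclic ([set u; v] |: (J :\ e)).
  apply: acyclicU; first by apply: acyclicW acJ; apply: subsetDl.
  by rewrite eE; apply: contra nxv; apply: connect_trans.
have <- : #|[set u; v] |: (J :\ e)| = #|J|.
  by rewrite cardsU1 in_setD1 (negbTE nJuv) andbF [in RHS](cardsD1 e) eJ.
apply: IH => //.
- apply: leq_trans leJ; rewrite [X in (_ < X)%N](cardsD1 e) inE nAe eJ ltnS.
  apply/subset_leq_card/subsetP => f; rewrite !inE => /andP[nAf /predU1P[fE|]].
    by rewrite fE [_ \in A]Auv in nAf.
  by case/andP=> -> ->; rewrite nAf.
- by move=> f; rewrite !inE => /predU1P[->|/andP[_ /J2//]]; rewrite cards2 nuv.
- move=> a b; rewrite /link !inE => /predU1P[abE|/andP[_ /spJ//]].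
  by apply: connect1; rewrite /link abE.
Qed.

End EdgeSets.

Section GraphicMatroid.
Variable G : sgraph.
Implicit Types (A B J X : {set {set G}}) (x y : G).

Definition edges : {set {set G}} := [set [set p.1; p.2] | p : G * G & adj p.1 p.2].

Definition forests : {set {set {set G}}} :=
  [set A : {set {set G}} | (A \subset edges) && acyclic A].

Lemma edgesP e : reflect (exists x y, adj x y /\ e = [set x; y]) (e \in edges).
Proof.
apply: (iffP imsetP) => [[[x y]]|[x [y [axy ->]]]].
  by rewrite inE => axy ->; exists x, y.
by exists (x, y); rewrite ?inE.
Qed.

Lemma adj_neq x y : adj x y -> x != y.
Proof. by apply: contraTneq => ->; rewrite adj_irrefl. Qed.

Lemma edges_card2 e : e \in edges -> #|e| = 2%N.
Proof. by case/edgesP=> x [y [/adj_neq nxy ->]]; rewrite cards2 nxy. Qed.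

Lemma link_edges x y : link edges x y = adj x y.
Proof.
apply/edgesP/idP => [[u [v [auv /set2_eq[[-> ->]|[-> ->]]]]]|axy] //.
  by rewrite adj_sym.
by exists x, y.
Qed.

Lemma forests_edges A : A \in forests -> A \subset edges.
Proof. by rewrite inE => /andP[]. Qed.

Lemma forests_set0 : set0 \in forests.
Proof.
rewrite inE sub0set; apply/asboolP => -[|x [|y p]] //.
by rewrite /ucycle /= /link inE.
Qed.

Lemma forests_subset A B : A \subset B -> B \in forests -> A \in forests.
Proof.
move=> sAB; rewrite !inE => /andP[sB acB].
by rewrite (subset_trans sAB sB) (acyclicW sAB acB).
Qed.

Lemma forests_add A x y : A \in forests -> adj x y ->
  ~~ connect (link A) x y -> [set x; y] |: A \in forests.
Proof.
rewrite !inE => /andP[sA acA] axy nxy; rewrite acyclicU // andbT.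
by rewrite subUset sub1set sA andbT -[_ \in _]/(link edges x y) link_edges.
Qed.

Lemma forest_span_card A J : J \in forests ->
  (forall x y, link J x y -> connect (link A) x y) -> (#|J| <= #|A|)%N.
Proof.
rewrite inE => /andP[sJ acJ]; apply: acyclic_span_card acJ _ => e eJ.
by apply: edges_card2; apply: (subsetP sJ).
Qed.

Lemma forests_augment A B : A \in forests -> B \in forests -> (#|A| < #|B|)%N ->
  exists2 e, e \in B :\: A & e |: A \in forests.
Proof.
move=> fA fB ltAB.
have [x [y [Bxy nAxy]]] : exists x y, link B x y /\ ~~ connect (link A) x y.
  apply: contrapT => h; move: ltAB; rewrite ltnNge forest_span_card // => x y Bxy.
  by apply/negP => /negP nAxy; apply: h; exists x, y.
have axy : adj x y.
  by rewrite -link_edges; apply: sub_link Bxy; apply: forests_edges.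
exists [set x; y]; last exact: forests_add.
by rewrite inE [_ \in B]Bxy andbT; apply: contra nAxy => Axy; apply: connect1.
Qed.

Definition graphic_matroid : matroid {set G} :=
  Matroid forests_edges forests_set0 forests_subset forests_augment.

Lemma graphic_flatP (F : {set {set G}}) : F \subset edges ->
  is_flat graphic_matroid F <->
  forall x y, adj x y -> connect (link F) x y -> [set x; y] \in F.
Proof.
move=> sF; have [B /andP[fB sBF] rB] := rank_basis graphic_matroid F.
have spB : subrel (connect (link F)) (connect (link B)).
  apply: connect_sub => x y Fxy; apply/negPn/negP => nB.
  have axy : adj x y by rewrite -link_edges; apply: sub_link Fxy.
  have := leq_rank (A := F) (forests_add fB axy nB : _ \in indep graphic_matroid).
  rewrite subUset sub1set [_ \in F]Fxy sBF => /(_ isT).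
  rewrite rB cardsU1; case: (boolP (_ \in B)) => [Bxy _|_]; last by rewrite add1n ltnn.
  by rewrite connect1 in nB.
rewrite /is_flat sF /=; split=> [/forall_inP fl x y axy cxy|fl]; last apply/forall_inP => e.
  apply/negPn/negP => nF.
  have := fl [set x; y]; rewrite inE nF -link_edges in axy * => /(_ axy).
  have [J /andP[fJ sJ] ->] := rank_basis graphic_matroid ([set x; y] |: F).
  rewrite rB ltnNge forest_span_card // => a b Jab; apply: spB.
  have := subsetP sJ _ Jab; rewrite in_setU1 => /predU1P[/set2_eq[[-> ->]|[-> ->]]|Fab] //.
    by rewrite connect_link_sym.
  exact: connect1.
case/setDP=> /edgesP[x [y [axy ->]]] nF; rewrite rB.
have nB : ~~ connect (link B) x y.
  by apply: contra nF => /(sub_connect_link sBF)/(fl _ _ axy).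
have := leq_rank (forests_add fB axy nB : _ \in indep graphic_matroid) (setUS _ sBF).
rewrite cardsU1; have -> // : [set x; y] \notin B.
by apply: contra nF; apply: (subsetP sBF).
Qed.

Definition edge_connected A : bool :=
  [forall x in cover A, forall y in cover A, connect (link A) x y].

Definition connected_flats : {set flat graphic_matroid} :=
  [set F : flat graphic_matroid | (F != set0 :> {set _}) && edge_connected F].

Implicit Types (F P Q : flat graphic_matroid).

Lemma flat_edges P : P \subset edges.
Proof. exact: flat_ground. Qed.

Lemma flat_link_adj P x y : link P x y -> adj x y.
Proof. by rewrite -link_edges; apply/sub_link/flat_edges. Qed.

Lemma flat_linkP P x y : adj x y -> connect (link P) x y -> link P x y.
Proof.
by move=> axy cxy; apply: (iffLR (graphic_flatP (flat_edges P)) (flatP P)).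
Qed.

Lemma flat_bot_set0 : (\bot%O : flat graphic_matroid) = set0 :> {set _}.
Proof.
apply/eqP; rewrite -subset0; apply: flat_closure_min => //.
apply/graphic_flatP; first exact: sub0set.
move=> x y axy /connectP[[|z p]]; last by rewrite /= /link inE.
by move=> _ /= yx; rewrite yx adj_irrefl in axy.
Qed.

Lemma coverP A x : reflect (exists2 e, e \in A & x \in e) (x \in cover A).
Proof. exact: bigcupP. Qed.

Lemma link_cover A x y : link A x y -> (x \in cover A) && (y \in cover A).
Proof.
by move=> Axy; apply/andP; split; apply/coverP; exists [set x; y];
  rewrite ?set21 ?set22.
Qed.

Lemma cover_link A x : A \subset edges -> x \in cover A -> exists y, link A x y.
Proof.
move=> sA /coverP[e eA xe]; have /edgesP[u [v [_ eE]]] := subsetP sA _ eA.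
move: eA xe; rewrite eE => Auv /set2P[->|->]; first by exists v.
by exists u; rewrite link_sym.
Qed.

Lemma connect_cover A x y : connect (link A) x y -> x != y -> x \in cover A.
Proof.
case/connectP=> -[|z p] /=; first by move=> _ ->; rewrite eqxx.
by case/andP=> /link_cover/andP[].
Qed.

(* The connected component of x in the edge set X. *)
Definition component X x : {set {set G}} :=
  [set e in X | [exists y in e, connect (link X) x y]].

Lemma component_sub X x : component X x \subset X.
Proof. by apply/subsetP => e; rewrite inE => /andP[]. Qed.

Lemma component_link X x u v :
  link (component X x) u v = link X u v && connect (link X) x u.
Proof.
rewrite /link inE -/(link X u v); case Xuv: (link X u v) => //=.
apply/exists_inP/idP => [[w /set2P[->|->] //]|xu].
  by move=> xv; apply: connect_trans xv _; rewrite connect1 // link_sym.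
by exists u; rewrite ?set21.
Qed.

Lemma component_connect X x u y : connect (link X) x u ->
  connect (link X) u y -> connect (link (component X x)) u y.
Proof.
move=> xu /connectP[p]; elim: p u xu => [|v p IH] u xu /=; first by move=> _ ->.
case/andP=> uv pth yE; apply: connect_trans (IH v _ pth yE).
  by apply: connect1; rewrite component_link uv.
by apply: connect_trans xu (connect1 uv).
Qed.

Lemma component_cover X x u : X \subset edges ->
  u \in cover (component X x) -> connect (link X) x u.
Proof.
move=> sX /cover_link[|v]; first exact: subset_trans (component_sub X x) sX.
by rewrite component_link => /andP[].
Qed.

Lemma component_flat P x : is_flat graphic_matroid (component P x).
Proof.
have sC := component_sub P x.
apply/graphic_flatP => [|u v auv cuv]; first exact: subset_trans sC (flat_edges P).
rewrite -[_ \in _]/(link (component P x) u v) component_link.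
rewrite (flat_linkP auv) /=; last exact: sub_connect_link cuv.
apply: component_cover (flat_edges P) _; apply: connect_cover cuv _.
exact: adj_neq.
Qed.

Definition component_flat_of P x : flat graphic_matroid := Flat (component_flat P x).

Lemma component_connected P x : x \in cover P ->
  component_flat_of P x \in connected_flats.
Proof.
case/(cover_link (flat_edges P)) => y Pxy.
rewrite inE; apply/andP; split.
  apply/set0Pn; exists [set x; y].
  by rewrite -[_ \in _]/(link (component P x) x y) component_link Pxy connect0.
apply/forall_inP => u /(component_cover (flat_edges P)) xu.
apply/forall_inP => v /(component_cover (flat_edges P)) xv.
apply: component_connect => //; apply: connect_trans xv.
by rewrite connect_link_sym.
Qed.

Lemma connected_sub_component P  F x : F \in connected_flats -> (F <= P)%O ->
  x \in cover F -> (F <= component_flat_of P x)%O.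
Proof.
rewrite inE flat_leE => /andP[_ /forall_inP cF] sFP xF.
rewrite flat_leE; apply/subsetP => e eF.
have /edgesP[u [v [_ eE]]] := subsetP (flat_edges F) _ eF.
rewrite eE in eF *; rewrite -[_ \in _]/(link (component P x) u v) component_link.
rewrite [link P u v](subsetP sFP) //=; apply: sub_connect_link sFP _ _ _.
by have /forall_inP := cF _ xF; apply; case/andP: (link_cover eF).
Qed.

Lemma component_max_below P x : x \in cover P ->
  component_flat_of P x \in max_below connected_flats P.
Proof.
move=> xP; rewrite inE component_connected // flat_leE component_sub /=.
apply/forall_inP => F cF; apply/implyP => /andP[sCF sFP].
have [y Pxy] := cover_link (flat_edges P) xP.
have xF : x \in cover F.
  apply/coverP; exists [set x; y]; rewrite ?set21 //.
  apply: (subsetP sCF); rewrite -[_ \in _]/(link (component P x) x y).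
  by rewrite component_link Pxy connect0.
by rewrite eq_le sCF connected_sub_component.
Qed.

Lemma max_below_component P  F x : F \in max_below connected_flats P ->
  x \in cover F -> F = component_flat_of P x.
Proof.
rewrite inE => /and3P[cF sFP /forall_inP maxF] xF.
have xP : x \in cover P.
  by case/coverP: xF => e eF xe; apply/coverP; exists e => //; apply: (subsetP sFP).
have := maxF _ (component_connected xP).
by rewrite connected_sub_component // [(_ <= P)%O]component_sub => /eqP.
Qed.

Lemma union_max_below_flat P (f : {ffun flat graphic_matroid -> flat graphic_matroid}) :
  f \in max_below_prod connected_flats P ->
  is_flat graphic_matroid (\bigcup_(F in max_below connected_flats P) f F).
Proof.
case/pfamilyP=> _ lef; set M := max_below _ _ in lef *; set U := \bigcup_(F in M) _.
have sfF F : F \in M -> f F \subset F by move/lef; rewrite inE.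
have sameF F1 F2 x : F1 \in M -> F2 \in M -> x \in cover (f F1) ->
    x \in cover (f F2) -> F1 = F2.
  have subc F : F \in M -> x \in cover (f F) -> x \in cover F.
    move=> FM /coverP[e ef xe]; apply/coverP; exists e => //.
    exact: subsetP (sfF F FM) _ ef.
  move=> M1 M2 /(subc _ M1) x1 /(subc _ M2) x2.
  by rewrite (max_below_component M1 x1) (max_below_component M2 x2).
apply/graphic_flatP => [|x y axy cxy].
  by apply/bigcupsP => F _; apply: flat_edges.
have linkU u v : link U u v -> exists2 F, F \in M & link (f F) u v.
  by case/bigcupP=> F FM; exists F.
have [F FM fy] : exists2 F, F \in M & x \in cover (f F).
  have /coverP[e /bigcupP[F FM ef] xe] := connect_cover cxy (adj_neq axy).
  by exists F => //; apply/coverP; exists e.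
apply/bigcupP; exists F => //; apply: flat_linkP => //.
case/connectP: cxy => p; elim: p x fy {axy} => [|z p IH] x xF /=; first by move=> _ ->.
case/andP=> /linkU[F' FM' xz] pth yE; have /andP[xF' zF'] := link_cover xz.
rewrite -(sameF _ _ _ FM FM' xF xF') in xz zF'.
exact: connect_trans (connect1 xz) (IH _ zF' pth yE).
Qed.

Lemma connected_flats_building : is_building_set connected_flats.
Proof.
split=> [|P]; first by rewrite inE flat_bot_set0 eqxx.
set M := max_below connected_flats P.
have leMP F : F \in M -> (F <= P)%O by rewrite inE => /and3P[].
split=> [f /pfamilyP[_ lef]|f g hf hg|Q leQP].
- apply/joinsP => F FM; apply: le_trans (leMP F FM).
  by have := lef F FM; rewrite inE.
- have [/supportP f0 lef] := pfamilyP hf.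
  apply/idP/forallP => [lefg F|lefg]; last first.
    apply/joinsP => F FM; apply: le_trans (lefg F) _.
    exact: (joins_sup (fun F => g F)).
  have [FM|nFM] := boolP (F \in M); last by rewrite f0 ?le0x.
  have sgU : (join_map connected_flats P g <= Flat (union_max_below_flat hg))%O.
    by apply/joinsP => F' FM'; rewrite flat_leE /= (bigcup_sup F').
  have sfU : (f F <= Flat (union_max_below_flat hg))%O.
    by apply: le_trans (le_trans lefg sgU); apply: joins_sup.
  rewrite flat_leE in sfU *; apply/subsetP => e ef.
  have /bigcupP[F' FM' eg] := subsetP sfU _ ef.
  have eF : e \in F by have := lef F FM; rewrite inE => /subsetP; apply.
  have eF' : e \in F'.
    by have [_ leg] := pfamilyP hg; have := leg F' FM'; rewrite inE => /subsetP; apply.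
  have /edgesP[x [y [_ eE]]] := subsetP (flat_edges F) _ eF.
  have xe : x \in e by rewrite eE set21.
  suff -> : F = F' by [].
  rewrite (max_below_component FM (x := x)); last by apply/coverP; exists e.
  by rewrite -(max_below_component FM') //; apply/coverP; exists e.
- pose f := [ffun F => if F \in M then (Q `&` F)%O else \bot%O].
  exists f.
    apply/pfamilyP; split=> [|F FM]; last by rewrite inE ffunE FM leIr.
    by apply/supportP => F nFM; rewrite ffunE (negbTE nFM).
  apply/le_anti/andP; split.
    by apply/joinsP => F FM; rewrite ffunE FM leIl.
  rewrite flat_leE; apply/subsetP => e eQ.
  have /edgesP[x [y [_ eE]]] := subsetP (flat_edges Q) _ eQ.
  have xP : x \in cover P.
    by apply/coverP; exists e; [apply: (subsetP leQP)|rewrite eE set21].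
  have CM := component_max_below xP.
  have : (f (component_flat_of P x) <= join_map connected_flats P f)%O.
    exact: (joins_sup (fun F => f F)).
  rewrite flat_leE ffunE CM => /subsetP; apply.
  rewrite [in X in _ \in X]/= in_setI eQ eE.
  rewrite -[_ \in component P x]/(link (component P x) x y).
  rewrite component_link connect0 andbT.
  by rewrite /link -eE; apply: (subsetP leQP).
Qed.

Definition graph_building_set : building_set (flat graphic_matroid) :=
  BuildingSet connected_flats_building.

End GraphicMatroid.

(* Main.v *)
Require Import Defs.
From HB Require Import structures.
From mathcomp Require Import all_boot all_order all_algebra.
From mathcomp Require Import boolp.
From mathcomp Require Import mpoly.
From mathcomp Require Import bigenough ssrcomplements zify ring.

(** Write h_S for the generator attached to the connected flat with vertex set
    S. If A and B are connected vertex sets with a common vertex and U is their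
    union, then (h_U - h_A)(h_U - h_B) = 0. These pair relations generate all
    the relations between the h_S (antichain_relation_in), once h_S = 0 is
    imposed for the edges S, and they only involve vertex sets.

    Chordality of G enters once, through a perfect elimination ordering of the
    vertices (elimination_order_exists): for such an ordering, the initial
    segments of a connected set are connected, and so is a connected set minus
    its last vertex. With these additional connected sets, the pair relations
    combine into one rewriting rule for each product h_A h_B such that {A, B}
    is not a normal pair (rewriting_rule_exists). Its leading term is h_A h_B
    for the degree-lexicographic order in which sets with a later last vertex
    come first and, among sets with the same last vertex, smaller sets come
    first.

    These rules form a Groebner basis as soon as the monomials that contain no
    such product, the standard ones, are linearly independent in the ring
    (quadratic_basis_groebner). Being a normal pair does not depend on the
    edges of G, so independence may be tested with functionals defined on
    products of arbitrary vertex sets, as if G were complete. In that case the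
    ring is the cohomology of the moduli space of stable rational curves with
    one marked point for each vertex and one more. A product of the h_S of
    complementary degree has degree 0 or 1, according to a condition of
    Hall-Rado type (dragon); that the degree kills the pair relations follows
    from the submodularity of the cardinality (dragon_functional). The
    functionals for all degrees are the degrees on the boundary strata, which
    are products of smaller spaces (stratum).

    Independence follows by induction on the vertex set V, with last vertex n
    (normal_separated). A standard monomial has at most one factor h_X with X
    containing n. Its other factors split into a standard monomial on X minus n
    and a standard monomial on V with X contracted to a point. A functional on
    X minus n, extended to X by integration along the map that forgets n,
    multiplied by a functional on the contraction, detects this monomial, and
    the resulting pairing is triangular with respect to the size of X. *)

Set Implicit Arguments.
Unset Strict Implicit.
Unset Printing Implicit Defensive.
Import Order.TTheory GRing.Theory BigEnough.
Local Open Scope quotient_scope.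

(** * Functionals vanishing on the pair relations *)

Section Functionals.
Variable T : finType.
Implicit Types (A B F S U V W X Z : {set T}) (M N : seq {set T}).
Implicit Types (x y n : T) (phi psi : seq {set T} -> bool).

(** What is needed for the linear extension of phi to vanish on the
    Feichtner-Yuzvinsky ideal: functional_small is h_A = 0 for an edge A, and
    functional_rel is the pair relation of A and B multiplied by a monomial. *)
Record FY_functional phi : Prop := FYFunctional {
  functional_perm : forall M N, perm_eq M N -> phi M = phi N;
  functional_small : forall A M, (#|A| <= 2)%N -> phi (A :: M) = false;
  functional_rel : forall A B M, A :&: B != set0 ->
    (phi [:: A :|: B, A :|: B & M] + phi [:: A, B & M] =
     phi [:: A :|: B, A & M] + phi [:: A :|: B, B & M])%N }.

(** The degree of a product of classes h_F on the space of stable rational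
    curves marked by W and one more point. It is 1 if and only if any j >= 1
    factors cover at least j + 2 points (the dragon marriage condition), and 0
    otherwise. It is enough to count all the factors contained in a given set
    S; the truncated subtraction bounds this number by 0 when S is small. *)
Definition dragon W M : bool :=
  (size M == #|W| - 2)%N &&
  [forall S : {set T}, count (fun F => F \subset S) M <= #|S| - 2]%N.

Lemma dragonP W M : reflect
  ((size M = #|W| - 2)%N /\
   forall S : {set T}, (count (fun F => F \subset S) M <= #|S| - 2)%N)
  (dragon W M).
Proof.
apply: (iffP andP) => [[/eqP ? /forallP h]|[? h]]; split=> //.
- by apply/eqP.
- exact/forallP.
Qed.

(** Let U be the union of A and B and assume that UUM, the product of h_U, h_U
    and M, satisfies the condition. If UAM does not, it fails at a set that
    contains A but not U and for which the number of factors of M is as large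
    as the bound allows. If UBM failed as well, the two sets would meet, since
    A and B do, and by submodularity of the cardinality UUM would fail at their
    union. Hence UAM or UBM has degree 1, and ABM fails exactly when one of
    them does: a set where only ABM fails would contain U, hence be excluded by
    UUM. *)
Lemma dragon_functional W : FY_functional (dragon W).
Proof.
split=> [M N pMN|A M A2|A B M AB].
- rewrite /dragon (perm_size pMN); congr (_ && _).
  by apply: eq_forallb => S; rewrite (permP pMN).
- apply/negP => /dragonP[_ /(_ A)] /=; rewrite subxx.
  by lia.
- set U := A :|: B; set c := fun S : {set T} => count (fun F => F \subset S) M.
  have [sz|nsz] := eqVneq (size M + 4)%N #|W|; last first.
    have d0 C D : dragon W [:: C, D & M] = false.
      by apply/negP => /andP[/eqP /=]; move/eqP: nsz; lia.
    by rewrite !d0.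
  have dE C D : dragon W [:: C, D & M] <->
      (forall S : {set T}, (C \subset S) + ((D \subset S) + c S) <= #|S| - 2)%N.
    split=> [/dragonP[_ h] S|h]; first exact: h.
    by apply/dragonP; split=> //=; lia.
  have sU S : (U \subset S) = (A \subset S) && (B \subset S) by rewrite subUset.
  have AU S : ((U \subset S) <= (A \subset S))%N by rewrite sU; do 2!case: (_ \subset _).
  have BU S : ((U \subset S) <= (B \subset S))%N by rewrite sU; do 2!case: (_ \subset _).
  have [dUU|/negP dUU] := boolP (dragon W [:: U, U & M]); last first.
    have d0 (C D : {set T}) : (forall S : {set T}, ((U \subset S) <= (C \subset S))%N) ->
        (forall S : {set T}, ((U \subset S) <= (D \subset S))%N) -> dragon W [:: C, D & M] = false.
      move=> CU DU; apply/negP => /dE h; apply: dUU; apply/dE => S.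
      by have := h S; have := CU S; have := DU S; lia.
    by rewrite !d0.
  move/dE: dUU => dUU.
  have tight (C : {set T}) : (forall S : {set T}, ((U \subset S) <= (C \subset S))%N) ->
      ~~ dragon W [:: U, C & M] -> exists2 S : {set T}, C \subset S & (#|S| <= c S + 2)%N.
    move=> CU /negP nd; apply: contrapT => h; apply: nd; apply/dE => S.
    have := dUU S; have := CU S; case: (boolP (U \subset S)) => US; case: (boolP (C \subset S)) => CS //=; try lia.
    move=> _ _; rewrite leqNgt; apply/negP => lt; apply: h; exists S => //; lia.
  case: (boolP (dragon W [:: U, A & M])) => [dUA|nUA]; last first.
    have -> : dragon W [:: A, B & M] = false.
      apply/negP => /dE h; case/negP: nUA; apply/dE => S.
      by have := h S; have := BU S; lia.
    case: (boolP (dragon W [:: U, B & M])) => // nUB.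
    have [S1 A1 t1] := tight A AU nUA; have [S2 B2 t2] := tight B BU nUB.
    have := dUU (S1 :|: S2); rewrite sU.
    rewrite (subset_trans A1 (subsetUl _ _)) (subset_trans B2 (subsetUr _ _)) /=.
    have := dUU (S1 :&: S2).
    have : (0 < #|S1 :&: S2|)%N.
      by rewrite card_gt0; apply: contraNneq AB => e; rewrite -subset0 -e setISS.
    have : (c S1 + c S2 <= c (S1 :|: S2) + c (S1 :&: S2))%N.
      rewrite /c; elim: (M) => //= F M' IH.
      have h : ((F \subset S1) + (F \subset S2) <= (F \subset S1 :|: S2) + (F \subset S1 :&: S2))%N.
        rewrite subsetI; case: (boolP (F \subset S1)) => F1; case: (boolP (F \subset S2)) => F2 //=.
        - by rewrite (subset_trans F1 (subsetUl _ _)).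
        - by rewrite (subset_trans F1 (subsetUl _ _)).
        - by rewrite (subset_trans F2 (subsetUr _ _)).
      lia.
    have := cardsUI S1 S2; lia.
  case: (boolP (dragon W [:: U, B & M])) => [dUB|nUB].
    suff -> : dragon W [:: A, B & M] by [].
    apply/dE => S; have := dUU S; move/dE/(_ S): dUA; move/dE/(_ S): dUB.
    by rewrite sU; case: (A \subset S); case: (B \subset S) => /=; lia.
  have -> // : dragon W [:: A, B & M] = false.
  apply/negP => /dE h; case/negP: nUB; apply/dE => S.
  by have := h S; have := AU S; lia.
Qed.

(** Together with dragon_ext, integration along the fibres of the map that
    forgets n: classes of sets without n are pulled back, and h_S has degree 1
    on the fibres when S is the whole vertex set. *)
Lemma dragon_kill W n M : n \notin W -> (2 <= #|W|)%N ->
  all (fun F => F \subset W) M -> dragon (n |: W) M = false.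
Proof.
move=> nW W2; rewrite all_count => /eqP MW; apply/negP => /dragonP[sz /(_ W)].
by rewrite MW; move: sz; rewrite cardsU1 nW; lia.
Qed.

Lemma dragon_ext W n M : n \notin W -> (2 <= #|W|)%N ->
  all (fun F => F \subset W) M -> dragon (n |: W) ((n |: W) :: M) = dragon W M.
Proof.
move=> nW W2 MW; apply/dragonP/dragonP; rewrite cardsU1 nW /= => -[sz h]; split=> [|S].
- lia.
- have := h S; lia.
- lia.
- have := h S; case: (boolP (n |: W \subset S)) => [nWS _|_ /=]; last lia.
  have := subset_leq_card nWS; rewrite cardsU1 nW.
  have := count_size (fun F => F \subset S) M; lia.
Qed.

Definition contract X x F := if [disjoint F & X] then F else x |: (F :\: X).

Lemma contract_meet X x F : F :&: X != set0 -> contract X x F = x |: (F :\: X).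
Proof. by rewrite /contract -setI_eq0 => /negbTE->. Qed.

Lemma contract_disjoint X x F : [disjoint F & X] -> contract X x F = F.
Proof. by rewrite /contract => ->. Qed.

Lemma card_contract X x F : (#|contract X x F| <= #|F|)%N.
Proof.
have [|mF] := eqVneq (F :&: X) set0.
  by move/eqP; rewrite setI_eq0 => /contract_disjoint->.
rewrite contract_meet // cardsU1 -(cardsID X F) leq_add2r.
by apply: leq_trans (leq_b1 _) _; rewrite card_gt0.
Qed.

(** The restriction to the boundary divisor of X, a product of two spaces: the
    classes of the sets inside X come from the first factor, the other ones
    from the second, on which the block X is represented by its point x. *)
Definition stratum X x phi psi M : bool :=
  phi [seq F : {set T} <- M | F \subset X] &&
  psi [seq contract X x F | F : {set T} <- M & ~~ (F \subset X)].

Lemma contract_rel X x A B : A :&: B != set0 -> ~~ (A \subset X) -> ~~ (B \subset X) ->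
  contract X x A :&: contract X x B != set0 /\
  contract X x (A :|: B) = contract X x A :|: contract X x B.
Proof.
move=> /set0Pn[y /setIP[yA yB]] nA nB.
have disjD C : C :&: X = set0 -> C :\: X = C.
  by move=> C0; rewrite -[RHS](setID C X) C0 set0U.
have [A0|AX] := eqVneq (A :&: X) set0; have [B0|BX] := eqVneq (B :&: X) set0.
- rewrite !contract_disjoint -?setI_eq0 ?A0 ?B0 //; last by rewrite setIUl A0 B0 setU0.
  by split=> //; apply/set0Pn; exists y; rewrite inE yA.
- have UX : (A :|: B) :&: X != set0 by rewrite setIUl A0 set0U.
  rewrite (contract_meet _ UX) (contract_meet _ BX) contract_disjoint -?setI_eq0 ?A0 //.
  rewrite setDUl (disjD A) // setUCA; split=> //; apply/set0Pn; exists y.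
  by move: yA; rewrite -(disjD A) // !inE yB => /andP[-> ->]; rewrite orbT.
- have UX : (A :|: B) :&: X != set0 by rewrite setIUl B0 setU0.
  rewrite (contract_meet _ UX) (contract_meet _ AX) contract_disjoint -?setI_eq0 ?B0 //.
  rewrite setDUl (disjD B) // setUA; split=> //; apply/set0Pn; exists y.
  by move: yB; rewrite -(disjD B) // !inE yA => /andP[-> ->]; rewrite orbT.
- have UX : (A :|: B) :&: X != set0.
    by apply: contraNneq AX => e; rewrite -subset0 -e setSI ?subsetUl.
  rewrite !contract_meet //; split.
    by apply/set0Pn; exists x; rewrite !inE eqxx.
  by rewrite setDUl setUUr.
Qed.

Lemma contract_rel_sub X x A B : A :&: B != set0 -> A \subset X ->
  contract X x (A :|: B) = contract X x B.
Proof.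
move=> AB AX.
have BX : B :&: X != set0.
  by apply: contraNneq AB => e; rewrite -subset0 -e setIC setIS.
have UX : (A :|: B) :&: X != set0.
  by apply: contraNneq BX => e; rewrite -subset0 -e setSI ?subsetUr.
rewrite !contract_meet //; congr (_ |: _).
by rewrite setDUl (_ : A :\: X = set0) ?set0U //; apply/eqP; rewrite setD_eq0.
Qed.

(** If A lies inside X and B does not, then B and A :|: B have the same
    contraction and the four terms of the relation cancel in pairs. Otherwise
    the relation is one of phi or of psi. *)
Lemma stratum_functional X x phi psi :
  FY_functional phi -> FY_functional psi -> FY_functional (stratum X x phi psi).
Proof.
move=> fphi fpsi; split=> [M N pMN|A M A2|A B M AB].
- rewrite /stratum; congr (_ && _).
    exact/(functional_perm fphi)/perm_filter.
  exact/(functional_perm fpsi)/perm_map/perm_filter.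
- rewrite /stratum /=; case: ifP => AX /=; first by rewrite (functional_small fphi).
  by rewrite andbC (functional_small fpsi) //; apply: leq_trans (card_contract _ _ _) A2.
- rewrite /stratum /= subUset.
  case: (boolP (A \subset X)) => AX; case: (boolP (B \subset X)) => BX /=.
  + set b := psi _; case: b; rewrite ?andbT ?andbF //; exact: (functional_rel fphi).
  + by rewrite (contract_rel_sub _ AB AX) addnC.
  + by rewrite setUC (contract_rel_sub _ _ BX) // setIC.
  + have [ABc ->] := contract_rel x AB AX BX.
    set b := phi _; case: b => //=; exact: (functional_rel fpsi).
Qed.

(** A functional Phi set0 on products of subsets of V, with extensions Phi Z to
    additional points Z. Adding a point n turns a functional that detects a
    monomial m on V into one that detects h_S m, where S is V with n, and that
    kills the monomials on V. Since this operation is iterated, extensions by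
    arbitrarily many points are part of the data. *)
Record extendable V (Phi : {set T} -> seq {set T} -> bool) : Prop := Extendable {
  extendable_functional : forall Z, [disjoint Z & V] -> FY_functional (Phi Z);
  extendable_kill : forall Z n M, [disjoint Z & V] -> n \notin V :|: Z ->
    (2 <= #|V :|: Z|)%N -> all (fun F => F \subset V :|: Z) M -> Phi (n |: Z) M = false;
  extendable_ext : forall Z n M, [disjoint Z & V] -> n \notin V :|: Z ->
    (2 <= #|V :|: Z|)%N -> all (fun F => F \subset V :|: Z) M ->
    Phi (n |: Z) ((n |: (V :|: Z)) :: M) = Phi Z M }.

Lemma extendable_dragon V : extendable V (fun Z => dragon (V :|: Z)).
Proof.
split=> [Z _|Z n M _ nVZ c2 MZ|Z n M _ nVZ c2 MZ]; first exact: dragon_functional.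
  by rewrite setUCA dragon_kill.
by rewrite setUCA dragon_ext.
Qed.

Lemma extendable_shift V n Phi : n \notin V -> extendable V Phi ->
  extendable (n |: V) (fun Z => Phi (n |: Z)).
Proof.
move=> nV [e1 e2 e3].
have dj Z : [disjoint Z & n |: V] -> [disjoint (n |: Z) & V] /\ V :|: (n |: Z) = (n |: V) :|: Z.
  move=> dZ; split; last by rewrite setUCA setUA.
  rewrite -setI_eq0 setIUl setU_eq0 !setI_eq0 disjoints1 nV.
  exact: disjointWr (subsetUr _ _) dZ.
split=> [Z /dj[d _]|Z k M /dj[d <-] kn c2 MZ|Z k M /dj[d <-] kn c2 MZ]; first exact: e1.
  by rewrite setUCA e2.
by rewrite setUCA e3.
Qed.

(** Additional points lie outside X, hence belong to the second factor. *)
Lemma extendable_stratum V X x phi Psi : X \subset V -> x \in X ->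
  FY_functional phi -> extendable (x |: (V :\: X)) Psi -> (2 <= #|x |: (V :\: X)|)%N ->
  extendable V (fun Z => stratum X x phi (Psi Z)).
Proof.
move=> XV xX fphi [e1 e2 e3] V2.
set V' := x |: _ in e1 e2 e3 V2.
have V'V : V' \subset V by rewrite subUset sub1set (subsetP XV) //= subsetDl.
have dj Z : [disjoint Z & V] -> [disjoint Z & V'] by apply: disjointWr.
have njU Z : V' :|: Z \subset V :|: Z by apply: setSU.
have c2 Z : (2 <= #|V' :|: Z|)%N by apply: leq_trans V2 (subset_leq_card (subsetUl _ _)).
have ncard n Z : n \notin V :|: Z -> n \notin V' :|: Z by apply: contra; apply: subsetP.
have cU F Z : [disjoint Z & V] -> F \subset V :|: Z -> contract X x F \subset V' :|: Z.
  move=> dZ FV; rewrite /contract; case: ifP => FX.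
    apply/subsetP => y yF; have := subsetP FV y yF; rewrite !inE => /orP[->|->]; rewrite ?orbT //.
    by rewrite (disjointFr FX yF) orbT.
  rewrite subUset sub1set !inE eqxx /=; apply/subsetP => y; rewrite !inE => /andP[-> yF].
  by have := subsetP FV y yF; rewrite !inE => /orP[->|->]; rewrite ?orbT.
have allc Z M : [disjoint Z & V] -> all (fun F => F \subset V :|: Z) M ->
    all (fun F => F \subset V' :|: Z) [seq contract X x F | F : {set T} <- M & ~~ (F \subset X)].
  move=> dZ /allP h; apply/allP => F /mapP[F']; rewrite mem_filter => /andP[_ /h F'V] ->.
  exact: cU.
split=> [Z /dj d|Z n M dZ nn _ MZ|Z n M dZ nn _ MZ].
- by apply: stratum_functional => //; apply: e1.
- by rewrite /stratum e2 ?andbF ?allc //; [apply: dj|apply: ncard].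
- have nX : ~~ (n |: (V :|: Z) \subset X).
    apply: contra nn => /subsetP/(_ n); rewrite !inE eqxx => /(_ isT) nX.
    by rewrite (subsetP XV).
  rewrite /stratum /= (negbTE nX) /=; congr (_ && _).
  suff -> : contract X x (n |: (V :|: Z)) = n |: (V' :|: Z).
    by rewrite e3 ?allc //; [apply: dj|apply: ncard].
  have nnX : n \notin X by apply: contra nn => nX'; rewrite inE (subsetP XV).
  rewrite contract_meet; last first.
    by apply/set0Pn; exists x; rewrite !inE xX (subsetP XV) // orbT.
  apply/setP => y; rewrite !inE; case: (eqVneq y n) => [->|_] /=; first by rewrite nnX orbT.
  rewrite andb_orr -orbA; congr (_ || (_ || _)).
  case: (boolP (y \in Z)) => // yZ; rewrite ?andbT ?andbF //.
  by apply: contraTN yZ => yX; rewrite (disjointFl dZ) // (subsetP XV).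
Qed.

End Functionals.

(** * Normal pairs and their contractions *)

Section Normal.
Variables (T : finType) (r : T -> nat).
Implicit Types (A B F S U V W X Z : {set T}) (x y n : T) (m : {set {set T}}).
Hypothesis r_inj : injective r.

Definition top_rank S : nat := (\max_(y in S) r y)%N.

Lemma leq_top_rank S y : y \in S -> (r y <= top_rank S)%N.
Proof. exact: (@leq_bigmax_cond _ (mem S) r). Qed.

Lemma top_rank_attained S : S != set0 -> exists2 z, z \in S & r z = top_rank S.
Proof.
move=> S0; have c0 : (0 < #|S|)%N by rewrite card_gt0.
by have [z zS e] := @eq_bigmax_cond _ (mem S) r c0; exists z.
Qed.

Lemma top_rank_sub S U : S \subset U -> (top_rank S <= top_rank U)%N.
Proof. by move=> SU; apply/bigmax_leqP => y yS; apply/leq_top_rank/(subsetP SU). Qed.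

(** Let U be the union of F and X. The product (h_X - h_U) h_F is the same for
    all connected sets F that meet X and complete it to U. The first two
    clauses single out the one whose variable is the smallest: it consists of
    the vertices of U up to a threshold, which is as low as possible. If U has
    only one vertex more than X, then h_X h_F = h_U h_F, so h_X h_F should be a
    leading term whatever F is, and the last clause excludes this case. *)
Definition initial_in F X : bool :=
  [&& [forall x in X, (r x <= top_rank F)%N ==> (x \in F)],
      [forall x in F :&: X, (r x < top_rank F)%N] || [forall x in F :&: X, r x == top_rank F]
    & (2 <= #|F :\: X|)%N].

Definition compatible F X : bool := [|| [disjoint F & X], F \subset X | initial_in F X].

(** The pairs whose product is not the leading term of a rewriting rule. Two
    sets with the same last vertex, equal or not, never form such a pair. *)
Definition normal_pair F X : bool := (top_rank F < top_rank X)%N && compatible F X.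

Lemma initialP F X : reflect
  [/\ forall x, x \in X -> (r x <= top_rank F)%N -> x \in F,
      (forall x, x \in F -> x \in X -> r x < top_rank F)%N \/
      (forall x, x \in F -> x \in X -> r x = top_rank F)
    & (2 <= #|F :\: X|)%N] (initial_in F X).
Proof.
apply: (iffP and3P) => -[h1 h2 h3]; split=> //.
- by move=> x xX xF; apply: (implyP (forall_inP h1 x xX)).
- case/orP: h2 => /forall_inP h; [left|right] => x xF xX; first by apply: h; rewrite inE xF.
  by apply/eqP/h; rewrite inE xF.
- by apply/forall_inP => x xX; apply/implyP; apply: h1.
- by apply/orP; case: h2 => h; [left|right]; apply/forall_inP => x /setIP[xF xX]; rewrite h.
Qed.

Definition normal_families V : {set {set {set T}}} :=
  [set m : {set {set T}} | [forall F in m, (F \subset V) && (2 < #|F|)%N] &&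
    [forall F in m, forall X in m, (F != X) ==> normal_pair F X || normal_pair X F]].

Lemma normal_familiesP V (m : {set {set T}}) : reflect
  ((forall F, F \in m -> F \subset V /\ (2 < #|F|)%N) /\
   {in m &, forall F X : {set T}, F != X -> normal_pair F X \/ normal_pair X F}) (m \in normal_families V).
Proof.
rewrite inE; apply: (iffP andP) => -[h1 h2]; split.
- by move=> F Fm; apply/andP/(forall_inP h1).
- by move=> F X Fm Xm FX; apply/orP; apply: (implyP (forall_inP (forall_inP h2 F Fm) X Xm)).
- by apply/forall_inP => F Fm; apply/andP/h1.
- by apply/forall_inP => F Fm; apply/forall_inP => X Xm; apply/implyP => FX; apply/orP/h2.
Qed.

Section Contraction.
Variables (X : {set T}) (w : T).
Hypotheses (wX : w \in X) (w_min : forall y, y \in X -> (r w <= r y)%N).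

Lemma meet_initial F : normal_pair F X -> ~~ (F \subset X) -> ~~ [disjoint F & X] ->
  initial_in F X.
Proof. by case/andP=> _ /or3P[->|->|]. Qed.

Lemma meet_min F : initial_in F X -> ~~ [disjoint F & X] -> w \in F.
Proof.
move=> /initialP[ini _ _]; rewrite -setI_eq0 => /set0Pn[y /setIP[yF yX]].
by apply: ini => //; apply: leq_trans (w_min yX) (leq_top_rank yF).
Qed.

Lemma contract_sub F : normal_pair F X -> ~~ (F \subset X) -> contract X w F \subset F.
Proof.
move=> nF FX; rewrite /contract; case: ifPn => // mF.
rewrite subUset sub1set subsetDl andbT.
by apply: meet_min => //; apply: meet_initial.
Qed.

Lemma top_rank_contract F : normal_pair F X -> ~~ (F \subset X) -> top_rank (contract X w F) = top_rank F.
Proof.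
move=> nF FX; apply/eqP; rewrite eqn_leq top_rank_sub ?contract_sub //=.
rewrite /contract; case: ifPn => // mF.
have iF := meet_initial nF FX mF; have wF := meet_min iF mF.
have [z zF zm] : exists2 z, z \in F & r z = top_rank F.
  by apply: top_rank_attained; apply: contraNneq FX => ->; apply: sub0set.
rewrite -zm; have [zX|zX] := boolP (z \in X); last by apply: leq_top_rank; rewrite !inE zX zF orbT.
suff -> : r z = r w by apply: leq_top_rank; rewrite !inE eqxx.
apply/eqP; rewrite eqn_leq w_min // andbT.
have [_ [h|h] _] := initialP _ _ iF; last by rewrite (h w wF wX) leq_top_rank.
by have := h z zF zX; rewrite zm ltnn.
Qed.

Lemma mem_contract_min F : ~~ (F \subset X) -> (w \in contract X w F) = ~~ [disjoint F & X].
Proof.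
move=> FX; rewrite /contract; case: ifPn => dF /=; last by rewrite !inE eqxx.
by rewrite (disjointFl dF wX).
Qed.

Lemma mem_contract_out F y : y \notin X -> (y \in contract X w F) = (y \in F).
Proof.
move=> yX; rewrite /contract; case: ifP => // _; rewrite !inE yX /=.
by case: eqVneq yX => // ->; rewrite wX.
Qed.

Lemma contract_meetX F y : y \in contract X w F -> y \in X -> y = w.
Proof.
rewrite /contract; case: ifP => [dF yF yX|_]; first by rewrite (disjointFr dF yF) in yX.
by rewrite !inE => /orP[/eqP//|/andP[/negbTE->]].
Qed.

(** F meets X in an initial segment of X, so F can be recovered from its
    contraction and from its top rank, which contraction preserves. *)
Lemma contract_inj F F' : normal_pair F X -> normal_pair F' X ->
  ~~ (F \subset X) -> ~~ (F' \subset X) -> contract X w F = contract X w F' -> F = F'.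
Proof.
move=> nF nF' FX FX' e.
have em : top_rank F = top_rank F' by rewrite -(top_rank_contract nF) // e top_rank_contract.
have ed : [disjoint F & X] = [disjoint F' & X].
  by apply: negb_inj; rewrite -!mem_contract_min // e.
apply/setP => y; have [yX|yX] := boolP (y \in X); last first.
  by rewrite -(mem_contract_out _ yX) e mem_contract_out.
have [d|m] := boolP [disjoint F & X].
  by rewrite (disjointFl d yX) (disjointFl _ yX) // -ed.
have [i1 _ _] := initialP _ _ (meet_initial nF FX m).
rewrite ed in m; have [i2 _ _] := initialP _ _ (meet_initial nF' FX' m).
apply/idP/idP => yF; [apply: i2 => //; rewrite -em|apply: i1 => //; rewrite em];
  exact: leq_top_rank.
Qed.

Lemma card_contract_gt2 F : normal_pair F X -> ~~ (F \subset X) -> (2 < #|F|)%N ->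
  (2 < #|contract X w F|)%N.
Proof.
move=> nF FX F2; rewrite /contract; case: ifPn => // mF.
have [_ _ h] := initialP _ _ (meet_initial nF FX mF).
by rewrite cardsU1 !inE wX /= add1n.
Qed.

(** Contraction preserves top ranks, and contracting to the first vertex of X
    puts no new vertex into a set. Only the last clause of initial_in needs
    care, when A meets X and B does not: it could fail only if all vertices of
    A outside X were in B, and then A would have at most one vertex outside B,
    or at most one outside X. *)
Lemma contract_normal_pair A B : normal_pair A X -> normal_pair B X ->
  ~~ (A \subset X) -> ~~ (B \subset X) -> normal_pair A B ->
  normal_pair (contract X w A) (contract X w B).
Proof.
move=> nA nB AX BX /andP[ltAB cAB]; rewrite /normal_pair !top_rank_contract // ltAB /=.
have sA := contract_sub nA AX; have sB := contract_sub nB BX.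
have [AB|nAB] := boolP (A \subset B).
  apply/or3P; apply: Or32; apply/subsetP => y yA.
  have [yX|yX] := boolP (y \in X); last first.
    by move: yA; rewrite !mem_contract_out //; apply: (subsetP AB).
  have yw := contract_meetX yA yX; move: yA; rewrite yw !mem_contract_min //.
  by apply: contra => d; apply: disjointWl d.
have [dAB|mAB] := boolP [disjoint A & B].
  apply/or3P; apply: Or31; apply: disjointWl sA _; exact: disjointWr sB _.
have iAB : initial_in A B by move: cAB; rewrite /compatible (negbTE nAB) (negbTE mAB).
have [i1 i2 i3] := initialP _ _ iAB.
apply/or3P; apply: Or33; apply/initialP; rewrite top_rank_contract //; split.
- move=> x xB xA; have xA' := i1 x (subsetP sB _ xB) xA.
  have [xX|xX] := boolP (x \in X); last by rewrite mem_contract_out.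
  have xw := contract_meetX xB xX; rewrite xw mem_contract_min // -setI_eq0.
  by apply/set0Pn; exists x; rewrite inE xA'.
- by case: i2 => h; [left|right] => x xA xB; apply: h; rewrite ?(subsetP sA) ?(subsetP sB).
have [dA|mA] := boolP [disjoint A & X].
  apply: leq_trans i3 _; apply: subset_leq_card; rewrite (contract_disjoint w dA).
  exact: setDS.
have iA := meet_initial nA AX mA; have [a1 a2 a3] := initialP _ _ iA.
have wA := meet_min iA mA.
have [dB|mB] := boolP [disjoint B & X]; last first.
  have iB := meet_initial nB BX mB; have [b1 b2 b3] := initialP _ _ iB.
  apply: leq_trans i3 _; apply/subset_leq_card/subsetP => y; rewrite !inE => /andP[yB yA].
  have yX : y \notin X.
    apply: contra yB => yX; apply: b1 => //; apply: leq_trans (leq_top_rank yA) (ltnW ltAB).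
  by rewrite !mem_contract_out // yB.
rewrite (contract_disjoint w dB).
have wB : w \notin B by rewrite (disjointFl dB).
have wc : w \in contract X w A by rewrite mem_contract_min.
have [y [yA yX yB]] : exists y, [/\ y \in A, y \notin X & y \notin B].
  apply: contrapT => nex.
  have inB y : y \in A -> y \notin X -> y \in B.
    by move=> yA yX; apply/negPn/negP => yB; apply: nex; exists y.
  have [z zA zm] : exists2 z, z \in A & r z = top_rank A by apply: top_rank_attained; apply/set0Pn; exists w.
  have [zX|zX] := boolP (z \in X).
    have h : forall x, x \in A -> x \in X -> x = z.
      case: a2 => h x xA xX; first by have := h z zA zX; rewrite zm ltnn.
      by apply: r_inj; rewrite zm h.
    suff : (#|A :\: B| <= 1)%N by rewrite leqNgt i3.
    rewrite -(cards1 z); apply/subset_leq_card/subsetP => y; rewrite !inE => /andP[yB yA].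
    by have [yX|yX] := boolP (y \in X); [rewrite (h y) //|rewrite inB in yB].
  have h : forall x, x \in A -> x \in B -> x = z.
    have zB := inB z zA zX.
    case: i2 => h x xA xB; first by have := h z zA zB; rewrite zm ltnn.
    by apply: r_inj; rewrite zm h.
  suff : (#|A :\: X| <= 1)%N by rewrite leqNgt a3.
  rewrite -(cards1 z); apply/subset_leq_card/subsetP => y; rewrite !inE => /andP[yX yA].
  by rewrite (h y) // inB.
have <- : #|[set w; y]| = 2%N by rewrite cards2; case: eqVneq yX => // <-; rewrite wX.
apply/subset_leq_card/subsetP => u; rewrite !inE => /orP[/eqP->|/eqP->].
  by rewrite wB.
by rewrite yB mem_contract_out.
Qed.

End Contraction.

Definition non_standard (k : nat) (var_set : 'I_k -> {set T}) : rel 'I_k := fun a b =>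
  (a == b) || ~~ (normal_pair (var_set a) (var_set b) || normal_pair (var_set b) (var_set a)).

End Normal.

(** * Linear independence of normal families *)

Local Open Scope ring_scope.

(** Independence over the integers: functions in S distinguish every nonzero
    combination of elements of N from zero. *)
Definition separates (A : finType) (N : {set A}) (S : (A -> int) -> Prop) : Prop :=
  forall c : A -> int, (forall f, S f -> \sum_(x in N) c x * f x = 0) ->
  {in N, forall x, c x = 0}.

(** The elements of P behave as pure tensors a x (x) b x; the functions on the
    two factors are used one after the other. *)
Lemma separates_product (A B C : finType) (N : {set B}) (N' : {set C}) S S'
    (P : {pred A}) (a : A -> B) (b : A -> C) (c : A -> int) :
  separates N S -> separates N' S' ->
  {in P, forall x, a x \in N} -> {in P, forall x, b x \in N'} ->
  {in P &, forall x y, a x = a y -> b x = b y -> x = y} ->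
  (forall f g, S f -> S' g -> \sum_(x in P) c x * (f (a x) * g (b x)) = 0) ->
  {in P, forall x, c x = 0}.
Proof.
move=> sN sN' aN bN ab0 h x0 Px0.
have h1 g : S' g -> {in N, forall y, \sum_(x in P | a x == y) c x * g (b x) = 0}.
  move=> Sg; apply: sN => f Sf; rewrite -[RHS](h f g Sf Sg).
  rewrite [RHS](partition_big a (mem N)) //=; apply: eq_bigr => y _.
  by rewrite mulr_suml; apply: eq_bigr => x /andP[_ /eqP->]; rewrite -mulrA [g _ * _]mulrC.
have h2 : {in N', forall z, \sum_(x in P | (a x == a x0) && (b x == z)) c x = 0}.
  apply: sN' => g Sg; rewrite -[RHS](h1 g Sg _ (aN _ Px0)).
  rewrite [RHS](partition_big b (mem N')) //=; last by move=> x /andP[/bN].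
  apply: eq_bigr => y _; rewrite mulr_suml.
  apply: eq_big => [x|x /and3P[_ _ /eqP->]] //.
  by rewrite andbA.
have := h2 _ (bN _ Px0); rewrite (big_pred1 x0) // => x.
apply/and3P/eqP => [[Px /eqP ea /eqP eb]|->]; last by rewrite !eqxx.
exact: ab0.
Qed.

Section Independence.
Variables (T : finType) (r : T -> nat).
Implicit Types (A B F S U V W X Z : {set T}) (x y n : T) (m : {set {set T}}).
Hypothesis r_inj : injective r.

Definition extendable_value V (f : {set {set T}} -> int) : Prop :=
  exists2 Phi, extendable V Phi & forall m, f m = (Phi set0 (enum m))%:R.

Lemma extendable_valueI V Phi : extendable V Phi ->
  extendable_value V (fun m => (Phi set0 (enum m))%:R).
Proof. by exists Phi. Qed.

Lemma exists_top V : V != set0 -> exists2 n, n \in V & forall y, y \in V -> (r y <= r n)%N.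
Proof.
by case/(top_rank_attained r) => n nV e; exists n => // y yV; rewrite e leq_top_rank.
Qed.

Lemma exists_bot V : V != set0 -> exists2 n, n \in V & forall y, y \in V -> (r n <= r y)%N.
Proof.
by case/set0Pn=> x0 x0V; case: (arg_minnP r x0V) => n nV h; exists n.
Qed.

Lemma top_rank_top V n F : (forall y, y \in V -> (r y <= r n)%N) -> F \subset V -> n \in F -> top_rank r F = r n.
Proof.
move=> top FV nF; apply/eqP; rewrite eqn_leq leq_top_rank // andbT.
by apply/bigmax_leqP => y yF; apply/top/(subsetP FV).
Qed.

Lemma normal_uniq_top V m n : (forall y, y \in V -> (r y <= r n)%N) -> m \in normal_families r V ->
  {in m &, forall F X : {set T}, n \in F -> n \in X -> F = X}.
Proof.
move=> top /normal_familiesP[sz pr] F X Fm Xm nF nX; apply/eqP/negPn/negP => FX.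
have mF := top_rank_top top (proj1 (sz F Fm)) nF; have mX := top_rank_top top (proj1 (sz X Xm)) nX.
by case: (pr F X Fm Xm FX) => /andP[+ _]; rewrite mF mX ltnn.
Qed.

Section Factor.
Variables (V X : {set T}) (n w : T).
Hypotheses (XV : X \subset V) (nX : n \in X).
Hypothesis top : forall y, y \in V -> (r y <= r n)%N.
Hypotheses (wX : w \in X) (w_min : forall y, y \in X -> (r w <= r y)%N).
Let W := X :\ n.
Let V' := w |: (V :\: X).

(** A normal family with member X through the last vertex n is encoded by two
    normal families: its members inside X minus n, and the contractions of its
    members not inside X. The block X is represented by its first vertex w, so
    that contraction keeps last vertices. *)
Definition inner m := [set F in m | F \subset W].
Definition outer m : {set {set T}} := contract X w @: [set F in m | ~~ (F \subset X)].

Lemma factor_pair m F : m \in normal_families r V -> X \in m -> F \in m -> F != X ->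
  normal_pair r F X /\ n \notin F.
Proof.
move=> mN Xm Fm FX; have nF : n \notin F.
  by apply: contra FX => nF; rewrite (normal_uniq_top top mN Fm Xm).
split=> //; have /normal_familiesP[sz pr] := mN.
case: (pr F X Fm Xm FX) => // /andP[+ _]; rewrite (top_rank_top top XV nX) ltnNge.
have [FV _] := sz F Fm; case/negP; apply/bigmax_leqP => y yF; exact/top/(subsetP FV).
Qed.

Lemma inner_mem m F : m \in normal_families r V -> X \in m -> F \in m -> F != X ->
  (F \subset X) = (F \subset W).
Proof.
move=> mN Xm Fm FX; have [_ nF] := factor_pair mN Xm Fm FX.
by rewrite subsetD1 nF andbT.
Qed.

Lemma inner_normal m : m \in normal_families r V -> inner m \in normal_families r W.
Proof.
case/normal_familiesP=> sz pr; apply/normal_familiesP; split=> [F|F F']; rewrite !inE.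
  by case/andP=> /sz[_ F2] FW.
by case/andP=> Fm _ /andP[Fm' _]; apply: pr.
Qed.

Lemma outer_normal m : m \in normal_families r V -> X \in m -> outer m \in normal_families r V'.
Proof.
move=> mN Xm; have /normal_familiesP[sz pr] := mN.
have outP F : F \in m -> ~~ (F \subset X) -> normal_pair r F X.
  by move=> Fm FX; apply: (proj1 (factor_pair mN Xm Fm _)); apply: contraNneq FX => ->.
apply/normal_familiesP; split=> [_ /imsetP[F + ->]|_ _ /imsetP[F + ->] /imsetP[F' + ->]]; rewrite !inE.
  case/andP=> Fm FX; have [FV F2] := sz F Fm; have nF := outP F Fm FX.
  split; last exact: (card_contract_gt2 wX nF).
  apply/subsetP => y yF; rewrite !inE.
  have [yX|yX] := boolP (y \in X); first by rewrite (contract_meetX yF yX) eqxx.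
  by rewrite (mem_contract_out wX) // in yF; rewrite (subsetP FV) ?orbT.
case/andP=> Fm FX /andP[Fm' FX'] ne.
have FF' : F != F' by apply: contraNneq ne => ->.
by case: (pr F F' Fm Fm' FF') => h; [left|right]; apply: contract_normal_pair => //; apply: outP.
Qed.

Lemma factor_sub m m' : m \in normal_families r V -> X \in m -> m' \in normal_families r V -> X \in m' ->
  inner m = inner m' -> outer m = outer m' -> m \subset m'.
Proof.
move=> mN Xm mN' Xm' ei eo; apply/subsetP => F Fm.
have [->//|FX] := eqVneq F X.
have [nF _] := factor_pair mN Xm Fm FX.
have [sFX|sFX] := boolP (F \subset X).
  have : F \in inner m by rewrite inE Fm -(inner_mem mN Xm).
  by rewrite ei inE => /andP[].
have : contract X w F \in outer m by apply: imset_f; rewrite inE Fm.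
rewrite eo => /imsetP[F']; rewrite inE => /andP[Fm' sFX'] e.
have FX' : F' != X by apply: contraNneq sFX' => ->.
have [nF' _] := factor_pair mN' Xm' Fm' FX'.
by rewrite (contract_inj wX w_min nF nF').
Qed.

Lemma factor_value m (phi psi : seq {set T} -> bool) : m \in normal_families r V -> X \in m ->
  FY_functional phi -> FY_functional psi ->
  stratum X w phi psi (enum m) =
    phi (X :: enum (inner m)) && psi (enum (outer m)).
Proof.
move=> mN Xm fphi fpsi; rewrite /stratum; congr (_ && _).
  apply: (functional_perm fphi); apply: uniq_perm.
  - exact/filter_uniq/enum_uniq.
  - by rewrite /= mem_enum enum_uniq andbT inE subsetD1 nX !andbF.
  - move=> F; rewrite in_cons mem_filter !mem_enum inE.
    have [->|FX] /= := eqVneq F X; first by rewrite subxx Xm.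
    by case Fm: (F \in m); rewrite ?andbF // andbT (inner_mem mN Xm).
apply: (functional_perm fpsi); apply: uniq_perm.
- rewrite map_inj_in_uniq; first exact/filter_uniq/enum_uniq.
  move=> F F'; rewrite mem_filter mem_enum => /andP[sF Fm]; rewrite mem_filter mem_enum => /andP[sF' Fm'].
  have FX : F != X by apply: contraNneq sF => ->.
  have FX' : F' != X by apply: contraNneq sF' => ->.
  have [nF _] := factor_pair mN Xm Fm FX; have [nF' _] := factor_pair mN Xm Fm' FX'.
  exact: (contract_inj wX w_min nF nF' sF sF').
- by rewrite enum_uniq.
- move=> F; rewrite mem_enum; apply/mapP/imsetP => -[F' + ->].
    by rewrite mem_filter mem_enum => /andP[h1 h2]; exists F'; rewrite ?inE ?h1 ?h2.
  by rewrite inE => /andP[h1 h2]; exists F' => //; rewrite mem_filter mem_enum h1 h2.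
Qed.

End Factor.

Lemma normal_small V m : (#|V| <= 2)%N -> m \in normal_families r V -> m = set0.
Proof.
move=> V2 /normal_familiesP[sz _]; apply/eqP; rewrite -subset0; apply/subsetP => F /sz[FV].
by rewrite ltnNge (leq_trans (subset_leq_card FV) V2).
Qed.

(** Induction on V, with last vertex n. A normal family has at most one member
    through n. The families that have none are detected by functionals that
    kill every set through n. The functional attached to X kills all families
    but those with a member through n contained in X. By induction on the size
    of X it remains to consider the families with member X, on which the
    functional is a product of a functional on X minus n and one on the
    contraction. *)
Lemma normal_separated V : separates (normal_families r V) (extendable_value V).
Proof.
have [k] := ubnP #|V|; elim: k V => // k IH V; rewrite ltnS => Vk c csum.
have [V1|V2] := leqP #|V| 1.
  move=> m mN; have m0 := normal_small (leq_trans V1 (leqnSn 1)) mN.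
  have e0 : normal_families r V = [set set0].
    apply/setP => m'; rewrite in_set1; apply/idP/eqP => [|->]; last by rewrite -m0.
    exact: (normal_small (leq_trans V1 (leqnSn 1))).
  have Phi_ext := extendable_dragon V.
  have := csum _ (extendable_valueI Phi_ext).
  rewrite e0 big_set1 enum_set0 m0.
  have -> : dragon (V :|: set0) [::]; last by rewrite mulr1.
  rewrite setU0; apply/dragonP; split=> //=.
  by case: #|V| V1 => [|[]].
have [n nV top] : exists2 n, n \in V & forall y, y \in V -> (r y <= r n)%N.
  by apply: exists_top; rewrite -card_gt0 (leq_trans _ V2).
have cV : #|V| = #|V :\ n|.+1 by rewrite (cardsD1 n V) nV.
have none : {in normal_families r V, forall m, (forall F : {set T}, F \in m -> n \notin F) -> c m = 0}.
  move=> m mN mn.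
  have subN m' : m' \in normal_families r V -> (forall F : {set T}, F \in m' -> n \notin F) ->
      m' \in normal_families r (V :\ n).
    case/normal_familiesP=> sz pr nm; apply/normal_familiesP; split=> // F Fm; have [FV F2] := sz F Fm.
    by rewrite subsetD1 FV nm.
  apply: (IH (V :\ n)) (subN m mN mn); first by rewrite -ltnS -cV ltnS.
  move=> f [Phi ePhi fE].
  have [x xV] : exists x, x \in V :\ n by apply/set0Pn; rewrite -card_gt0 -ltnS -cV.
  pose Psi := fun Z => stratum (V :\ n) x (Phi set0) (dragon ((x |: (V :\: (V :\ n))) :|: Z)).
  have VD : V :\: (V :\ n) = [set n].
    apply/setP => y; rewrite !inE; case: eqVneq => [->|_] //=; by case: (y \in V).
  have ePsi : extendable V Psi.
    apply: (extendable_stratum (Psi := fun Z => dragon ((x |: (V :\: (V :\ n))) :|: Z))) => //.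
    - exact: subsetDl.
    - by apply: (extendable_functional ePhi); rewrite -setI_eq0 set0I.
    - exact: extendable_dragon.
    - by rewrite VD cards2; case: eqVneq xV => // ->; rewrite !inE eqxx.
  have := csum _ (extendable_valueI ePsi).
  move=> sum0; rewrite -[RHS]sum0 [RHS](bigID (fun m' : {set {set T}} => m' \in normal_families r (V :\ n))) /=.
  rewrite [X in _ + X]big1 ?addr0 => [|m' /andP[mN' nm']].
    apply: eq_big => [m'|m' mN'].
      apply/idP/andP => [mN'|[]//]; split=> //.
      case/normal_familiesP: mN' => sz pr; apply/normal_familiesP; split=> // F Fm.
      have [FV F2] := sz F Fm; split=> //; apply: subset_trans FV (subsetDl _ _).
    rewrite fE; congr (_ * (_ : bool)%:R); rewrite /Psi /stratum.
    have /normal_familiesP[sz _] := mN'.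
    have fl : [seq F : {set T} <- enum m' | F \subset V :\ n] = enum m'.
      by apply/all_filterP/allP => F; rewrite mem_enum => /sz[].
    have fl' : [seq F : {set T} <- enum m' | ~~ (F \subset V :\ n)] = [::].
      apply/eqP; rewrite -[_ == _]negbK -has_filter; apply/hasPn => F.
      by rewrite mem_enum negbK => /sz[].
    rewrite fl fl' /= setU0 VD (_ : dragon _ _ = true) ?andbT //.
    by apply/dragonP; split=> //=; rewrite cards2; case: (_ != _).
  have [F Fm nF] : exists2 F : {set T}, F \in m' & n \in F.
    apply: contrapT => h; case/negP: nm'; apply: subN => // F Fm.
    by apply/negP => nF; apply: h; exists F.
  rewrite /Psi /stratum (_ : dragon _ _ = false) ?andbF ?mulr0 //.
  apply/negP => /dragonP[]; rewrite setU0 VD cards2 size_map.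
  have : F \in [seq F : {set T} <- enum m' | ~~ (F \subset V :\ n)].
    by rewrite mem_filter mem_enum Fm andbT subsetD1 nF andbF.
  by case: filter => //= ? ? _; case: (_ != _).
suff step j X : (#|X| < j)%N -> n \in X -> {in normal_families r V, forall m, X \in m -> c m = 0}.
  move=> m mN; have [h|h] := pselect (exists2 X : {set T}, X \in m & n \in X).
    by case: h => X Xm nX; apply: (step #|X|.+1 X).
  by apply: none => // F Fm; apply/negP => nF; apply: h; exists F.
elim: j X => // j IHj X; rewrite ltnS => Xj nX m mN Xm.
have /normal_familiesP[/(_ X Xm)[XV X2] _] := mN.
have X0 : X != set0 by rewrite -card_gt0 (leq_trans _ X2).
have [w wX w_min] := exists_bot X0.
set W := X :\ n; set V' := w |: (V :\: X).
have cX : #|X| = #|W|.+1 by rewrite (cardsD1 n X) nX.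
have W2 : (2 <= #|W|)%N by rewrite -ltnS -cX.
have nW : n \notin W by rewrite !inE eqxx.
have nWX : n |: W = X by rewrite setD1K.
have cV' : #|V'| = (#|V| - #|X|).+1 by rewrite cardsU1 !inE wX cardsD (setIidPr XV).
have XVc := subset_leq_card XV.
have sW : separates (normal_families r W) (extendable_value W) by apply: IH; rewrite -cX (leq_trans XVc).
have sV' : separates (normal_families r V') (extendable_value V') by apply: IH; lia.
pose P := [pred m' in normal_families r V | X \in m'].
apply: (separates_product (P := P) (a := inner X n) (b := outer X w) sW sV') => //.
- by move=> m' /andP[mN' _]; apply: inner_normal mN'.
- by move=> m' /andP[mN' Xm']; apply: (outer_normal XV nX top wX w_min mN').
- move=> m1 m2 /andP[mN1 Xm1] /andP[mN2 Xm2] ei eo; apply/eqP; rewrite eqEsubset.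
  by rewrite !(factor_sub (X := X) (n := n) XV nX top wX w_min).
- move=> f g [Phi ePhi fE] [Psi ePsi gE].
  have d0 (U : {set T}) : [disjoint set0 & U] by rewrite -setI_eq0 set0I.
  have dn : [disjoint n |: set0 & W] by rewrite setU0 disjoints1.
  have fPhi : FY_functional (Phi (n |: set0)) by apply: (extendable_functional ePhi).
  have fPsi : FY_functional (Psi set0) by apply: (extendable_functional ePsi).
  have nW0 : n \notin W :|: set0 by rewrite setU0.
  have W02 : (2 <= #|W :|: set0|)%N by rewrite setU0.
  pose phi := stratum X w (Phi (n |: set0)) (Psi set0).
  have sum0 : \sum_(m' in normal_families r V) c m' * (phi (enum m'))%:R = 0.
    (* If X is all of V, its contraction is a point and cannot be extended; *)
    (* the extension of Phi is then a functional on V by itself. *)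
    have [V'2|V'1] := leqP 2 #|V'|.
      apply: csum; exists (fun Z => stratum X w (Phi (n |: set0)) (Psi Z)) => //.
      exact: extendable_stratum.
    have XeV : X = V.
      by apply/eqP; rewrite eqEcard XV /= -subn_eq0 -leqn0 -ltnS -cV'.
    case psi0: (Psi set0 [::]); last first.
      apply: big1 => m' /normal_familiesP[sz _]; rewrite /phi /stratum.
      have -> : [seq F : {set T} <- enum m' | ~~ (F \subset X)] = [::].
        apply/eqP; rewrite -[_ == _]negbK -has_filter; apply/hasPn => F.
        by rewrite mem_enum negbK XeV => /sz[].
      by rewrite /= psi0 andbF mulr0.
    have ext : extendable V (fun Z => Phi (n |: Z)).
      by rewrite -XeV -nWX; apply: extendable_shift.
    rewrite -[RHS](csum _ (extendable_valueI ext)).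
    apply: eq_bigr => m' /normal_familiesP[sz _]; congr (_ * (_ : bool)%:R); rewrite /phi /stratum.
    have -> : [seq F : {set T} <- enum m' | ~~ (F \subset X)] = [::].
      apply/eqP; rewrite -[_ == _]negbK -has_filter; apply/hasPn => F.
      by rewrite mem_enum negbK XeV => /sz[].
    have -> : [seq F : {set T} <- enum m' | F \subset X] = enum m'.
      by apply/all_filterP/allP => F; rewrite mem_enum XeV => /sz[].
    by rewrite /= psi0 andbT.
  rewrite -[RHS]sum0 [RHS](bigID (fun m' : {set {set T}} => X \in m')) /=.
  rewrite [X in _ + X]big1 ?addr0 => [|m' /andP[mN' Xm']].
    apply: eq_big => [m'|m' /andP[mN' Xm']] //.
    rewrite /phi (factor_value (n := n) XV nX top wX w_min mN' Xm') //.
    rewrite fE gE -natrM mulnb; congr (_ * (_ && _)%:R).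
    rewrite -{2}nWX -[W in RHS]setU0 (extendable_ext ePhi) //.
    apply/allP => F; rewrite mem_enum inE => /andP[_].
    by rewrite setU0.
  have [h|h] := pselect (exists2 F : {set T}, F \in m' & (n \in F) && (F \subset X)).
    case: h => F Fm /andP[nF FX]; rewrite (IHj F) ?mul0r //.
    apply: leq_trans Xj; apply: proper_card; rewrite properEneq FX andbT.
    by apply: contraNneq Xm' => <-.
  rewrite /phi /stratum (extendable_kill ePhi) ?mulr0 //.
  apply/allP => F; rewrite mem_filter mem_enum setU0 subsetD1 => /andP[FX Fm].
  by rewrite FX; apply/negP => nF; apply: h; exists F; rewrite ?nF.
- by rewrite inE /= mN.
Qed.

End Independence.

Local Close Scope ring_scope.

(** * Perfect elimination orderings of chordal graphs *)

Section Chordal.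
Variable G : sgraph.
Implicit Types (S W A B : {set G}) (a b s t u v w x y : G) (p : seq G).

Lemma next_cat p x y p' : uniq (p ++ x :: y :: p') -> next (p ++ x :: y :: p') x = y.
Proof.
move=> up; rewrite -(next_rot (size p)) // rot_size_cat /=.
by rewrite eqxx.
Qed.

Hypothesis chordal_G : chordal G.

(** The path and v form a cycle. If the path is not a single edge, this cycle
    has a chord, which cannot involve v, and therefore shortens the path. *)
Lemma chordal_path_ends v s t p : path (@adj G) s p -> last s p = t ->
  (forall x, x \in p -> x != s -> x != t -> (x != v) && ~~ adj v x) ->
  s != t -> adj v s -> adj v t -> adj s t.
Proof.
have [k] := ubnP (size p); elim: k p => // k IH p; rewrite ltnS => pk pth lst int st vs vt.
case/shortenP: pth lst => p' pth' up' sub' lst'.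
have pk' : (size p' <= k)%N.
  apply: leq_trans pk; apply: uniq_leq_size; last exact: sub'.
  by case/andP: up'.
have {}int x : x \in p' -> x != s -> x != t -> (x != v) && ~~ adj v x by move/sub'; apply: int.
move: p' pth' up' {sub'} lst' pk' int => {pk}{}p pth up lst pk int.
have sv : s != v by apply: contraTneq vs => ->; rewrite adj_irrefl.
have tv : t != v by apply: contraTneq vt => ->; rewrite adj_irrefl.
have tp : t \in p.
  by rewrite -lst; case: (p) lst st => [/= ->|a q _ _]; rewrite ?eqxx //= mem_last.
have np : v \notin s :: p.
  rewrite in_cons negb_or eq_sym sv; apply/negP => vp.
  by have := int v vp; rewrite ![v == _]eq_sym sv tv eqxx => /(_ isT isT).
have adjv y : y \in s :: p -> adj v y -> y = s \/ y = t.
  rewrite in_cons => /orP[/eqP->|yp] avy; first by left.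
  have [->|ys] := eqVneq y s; first by left.
  have [->|yt] := eqVneq y t; first by right.
  by have := int y yp ys yt; rewrite avy andbF.
have [p1|p2] := leqP (size p) 1.
  case: (p) p1 pth lst st => [|z [|//]] _ /=; first by move=> _ ->; rewrite eqxx.
  by rewrite andbT => + <-.
pose c := v :: s :: p.
have uc : uniq c by rewrite /c cons_uniq np.
have cc : cycle (@adj G) c.
  by rewrite /c /= vs rcons_path pth lst adj_sym.
have nextv : next c v = s by rewrite /= eqxx.
have nextt : next c t = v.
  rewrite next_nth /c (_ : t \in _); last by rewrite !in_cons tp !orbT.
  rewrite -lst -[last s p]/(last v (s :: p)) index_last //.
  by rewrite nth_default.
have shortcut x y p1 p3 : p = p1 ++ p3 -> last s p1 = x -> y \in p3 -> adj x y ->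
    y != next c x -> adj s t.
  move=> pE lx yp axy; case/splitPr: yp pE => p4 p5 pE nxy.
  have p4n : p4 != [::].
    apply: contraNneq nxy => p4E; apply/eqP.
    have cE : exists q, c = q ++ x :: y :: p5.
      rewrite /c pE p4E /=; case: (lastP p1) lx => [/= <-|q z]; first by exists [:: v].
      by rewrite last_rcons => ->; exists (v :: s :: q); rewrite cat_rcons.
    by case: cE uc => q -> /next_cat->.
  apply: (IH (p1 ++ y :: p5)) => //.
  - apply: leq_trans pk; rewrite pE !size_cat /=.
    by rewrite ltn_add2l -{1}[(size p5).+1]add0n ltn_add2r lt0n size_eq0.
  - by move: pth; rewrite pE !cat_path /= lx axy => /and3P[-> _ /andP[_ ->]].
  - by rewrite -lst pE !last_cat.
  - move=> z zp; apply: int; rewrite pE !mem_cat !in_cons in zp *.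
    by case/or3P: zp => ->; rewrite ?orbT.
have c4 : (4 <= size c)%N by [].
have [x [y [xc yc axy nxy nyx]]] := chordal_G c4 (introT andP (conj cc uc)).
have nadj z : z \in s :: p -> adj v z -> z = next c v \/ v = next c z.
  by move=> zp /(adjv z zp)[->|->]; [left; rewrite nextv|right; rewrite nextt].
move: xc yc; rewrite ![_ \in c]in_cons.
case/predU1P=> [xv|xp]; first rewrite xv in axy nxy nyx.
  case/predU1P=> [yv|yp]; first by rewrite yv adj_irrefl in axy.
  by case: (nadj y yp axy) => e; [rewrite -e eqxx in nxy|rewrite -e eqxx in nyx].
case/predU1P=> [yv|yp]; first rewrite yv in axy nxy nyx.
  by rewrite adj_sym in axy; case: (nadj x xp axy) => e; [rewrite -e eqxx in nyx|rewrite -e eqxx in nxy].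
have xy : x != y by apply: contraTneq axy => ->; rewrite adj_irrefl.
have [q1 [q2 [pE lx]]] : exists q1 q2, p = q1 ++ q2 /\ last s q1 = x.
  by case/splitPl: (xp) => q1 q2 <-; exists q1, q2.
have : y \in s :: q1 ++ q2 by rewrite -pE.
rewrite -cat_cons mem_cat => /orP[yq1|yq2]; last exact: shortcut pE lx yq2 axy nxy.
case/splitPl: yq1 lx pE => q3 q4 ly lx pE.
apply: (shortcut y x q3 (q4 ++ q2)) => //; first by rewrite catA.
  rewrite mem_cat -lx last_cat ly; case: (q4) lx => [/= lx|z q _]; last by rewrite -[last y _]/(last z q) mem_last.
  by rewrite cats0 ly in lx; rewrite lx eqxx in xy.
by rewrite adj_sym.
Qed.

Definition adj_in S : rel G := fun x y => [&& x \in S, y \in S & adj x y].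

Lemma adj_in_sym S : connect_sym (adj_in S).
Proof.
by apply: sym_connect_sym => x y; rewrite /adj_in adj_sym andbCA.
Qed.

Lemma adj_in_mem S x y : connect (adj_in S) x y -> x \in S -> y \in S.
Proof.
case/connectP=> p; elim: p x => [|z p IH] x /=; first by move=> _ ->.
by case/andP=> /and3P[_ zS _] pth yE _; apply: IH pth yE zS.
Qed.

Definition simplicial_in W u := forall a b, a \in W -> b \in W ->
  adj u a -> adj u b -> a != b -> adj a b.

(** Dirac's argument. Let C be a connected component of the vertices of W away
    from v, and S the set of its neighbours in W. The elements of S are
    neighbours of v, so S is a clique by chordal_path_ends, and a vertex of C
    that is simplicial in C :|: S is simplicial in W. Such a vertex is found by
    induction, away from a vertex of C :|: S that is not adjacent to all the
    others, taken in S whenever possible. *)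
Lemma simplicial_away W v : v \in W ->
  (exists2 w, w \in W & (w != v) && ~~ adj v w) ->
  exists u, [/\ u \in W, u != v, ~~ adj v u & simplicial_in W u].
Proof.
have [k] := ubnP #|W|; elim: k W v => // k IH W v; rewrite ltnS => Wk vW [w wW /andP[wv nvw]].
pose D := [set x in W | (x != v) && ~~ adj v x].
pose C := [set x | connect (adj_in D) w x].
pose S := [set s in W | adj v s && [exists c in C, adj c s]].
have wD : w \in D by rewrite !inE wW wv nvw.
have CD x : x \in C -> [/\ x \in W, x != v & ~~ adj v x].
  rewrite inE => cx; have := adj_in_mem cx wD.
  by rewrite inE => /and3P.
have nbC c y : c \in C -> y \in W -> adj c y -> (y \in C) || (y \in S).
  move=> cC yW acy; have [cW cv nvc] := CD c cC.
  have [vy|nvy] := boolP (adj v y).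
    by apply/orP; right; rewrite inE yW vy; apply/exists_inP; exists c.
  have yv : y != v by apply: contraNneq nvc => <-; rewrite adj_sym.
  apply/orP; left; move: (cC); rewrite !inE => cC'; apply: connect_trans cC' (connect1 _).
  by rewrite /adj_in !inE cW cv nvc yW yv nvy.
have clS s t : s \in S -> t \in S -> s != t -> adj s t.
  rewrite !inE => /and3P[sW vs /exists_inP[c cC cs]] /and3P[tW vt /exists_inP[c' cC' ct]] st.
  have : connect (adj_in D) c c'.
    move: cC cC'; rewrite !inE => wc wc'; apply: connect_trans wc'.
    by rewrite adj_in_sym.
  case/connectP=> q pth lst.
  apply: (@chordal_path_ends v s t (c :: rcons q t)) => //.
  - rewrite /= adj_sym cs rcons_path -lst ct andbT.
    by apply: sub_path pth => x y /and3P[].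
  - by rewrite /= last_rcons.
  - move=> x; rewrite in_cons mem_rcons in_cons => /or3P[/eqP->|/eqP->|xq] xs xt.
    + by have [_ -> ->] := CD c cC.
    + by rewrite eqxx in xt.
    + suff : x \in D by rewrite inE => /andP[].
      elim: q c pth xq {cs cC lst} => //= z q IHq c /andP[/and3P[_ zD _] pth].
      by rewrite in_cons => /orP[/eqP->//|]; apply: IHq pth.
pose W' := C :|: S.
have W'W : W' \subset W.
  by apply/subsetP => x; rewrite in_setU => /orP[/CD[]|]; rewrite ?inE // => /andP[].
have ltW : (#|W'| < k)%N.
  apply: leq_trans Wk; apply: proper_card; rewrite properEneq W'W andbT.
  apply: contraTneq vW => <-; rewrite in_setU negb_or.
  apply/andP; split; first by apply/negP => /CD[]; rewrite eqxx.
  by rewrite inE adj_irrefl /= andbF.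
have wC : w \in C by rewrite inE connect0.
suff [u uC su] : exists2 u, u \in C & simplicial_in W' u.
  have [uW uv nvu] := CD u uC; exists u; split=> // a b aW bW ua ub ab.
  by apply: su; rewrite // in_setU (nbC u).
have [all_adj|/forallPn[s /forallPn[t nst]]] :=
    boolP [forall s, forall t, [&& s \in W', t \in W' & t != s] ==> adj s t].
  exists w => // a b aW bW _ _ ab.
  by apply: (implyP (forallP (forallP all_adj a) b)); rewrite aW bW eq_sym.
move: nst; rewrite negb_imply => /andP[/and3P[sW tW ts] nst].
have [[s' s'S [t' t'W /andP[t's' ns't']]]|nuniv] := pselect (exists2 s', s' \in S &
    exists2 t', t' \in W' & (t' != s') && ~~ adj s' t').
  have sW' : s' \in W' by rewrite in_setU s'S orbT.
  have [u [uW us nus su]] := IH W' s' ltW sW' (ex_intro2 _ _ t' t'W (introT andP (conj t's' ns't'))).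
  exists u => //; move: uW; rewrite in_setU => /orP[//|uS].
  by rewrite (clS s' u) // 1?eq_sym in nus.
have [u [uW us nus su]] := IH W' s ltW sW (ex_intro2 _ _ t tW (introT andP (conj ts nst))).
exists u => //; move: uW; rewrite in_setU => /orP[//|uS].
case: nuniv; exists u => //; exists s => //.
by rewrite eq_sym us adj_sym.
Qed.

Lemma simplicial_exists W : W != set0 -> exists2 u, u \in W & simplicial_in W u.
Proof.
case/set0Pn=> v vW.
have [[u [uW h]]|h] := pselect (exists u, u \in W /\
    exists2 w, w \in W & (w != u) && ~~ adj u w).
  by have [u' [uW' _ _ su]] := simplicial_away uW h; exists u'.
exists v => // a b aW bW _ _ ab; apply/negPn/negP => nab; apply: h.
by exists a; split=> //; exists b; rewrite // eq_sym ab.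
Qed.

(** r ranks the vertices by a perfect elimination ordering, the vertex of
    largest rank being eliminated first. *)
Definition elimination_order (r : G -> nat) := injective r /\
  forall v a b, adj v a -> adj v b -> (r a < r v)%N -> (r b < r v)%N -> a != b -> adj a b.

Lemma elimination_order_exists : exists r, elimination_order r.
Proof.
suff [r [r_inj r_elim]] : exists r : G -> nat, {in [set: G] &, injective r} /\
    {in [set: G] & &, forall v a b, adj v a -> adj v b -> (r a < r v)%N -> (r b < r v)%N ->
     a != b -> adj a b}.
  exists r; split=> [x y|v a b]; first by apply: r_inj; rewrite inE.
  by apply: r_elim; rewrite inE.
have [k] := ubnP #|[set: G]|; elim: k [set: G] => // k IH W; rewrite ltnS => Wk.
have [->|W0] := eqVneq W set0.
  by exists (fun=> 0); split=> x; rewrite inE.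
have [u uW su] := simplicial_exists W0.
have [|r [r_inj r_elim]] := IH (W :\ u).
  by apply: leq_trans Wk; rewrite [X in (_ < X)%N](cardsD1 u) uW.
pose M := (\max_x r x).+1.
have ltM x : (r x < M)%N by rewrite ltnS; apply: leq_bigmax.
pose r' x := if x == u then M else r x.
exists r'; split=> [x y xW yW|v a b vW aW bW va vb]; rewrite /r'.
  case: eqVneq => [->|xu]; case: eqVneq => [->|yu] // e.
  - by have := ltM y; rewrite -e ltnn.
  - by have := ltM x; rewrite e ltnn.
  - by apply: r_inj; rewrite // !inE ?xu ?yu.
have ltM' x : (M < r x)%N = false by apply/negP => h; have := ltn_trans (ltM x) h; rewrite ltnn.
case: (eqVneq v u) => [vu|vu]; first by rewrite vu in va vb; move=> _ _; apply: su.
case: (eqVneq a u) => [_|au]; rewrite ?ltM' //.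
case: (eqVneq b u) => [_|bu]; rewrite ?ltM' //.
by apply: r_elim; rewrite ?inE ?vu ?au ?bu.
Qed.

End Chordal.

Section ConnectedSets.
Variable G : sgraph.
Implicit Types (S W A B : {set G}) (a b s t u v w x y : G) (p : seq G).

Definition connected_set S : Prop := {in S &, forall x y, connect (adj_in S) x y}.

Lemma adj_in_sub S W : S \subset W -> subrel (connect (adj_in S)) (connect (adj_in W)).
Proof.
move=> SW; apply: connect_sub => x y /and3P[xS yS xy]; apply: connect1.
by rewrite /adj_in !(subsetP SW).
Qed.

Lemma connected_setU A B : A :&: B != set0 -> connected_set A -> connected_set B ->
  connected_set (A :|: B).
Proof.
case/set0Pn=> z /setIP[zA zB] cA cB.
have toz x : x \in A :|: B -> connect (adj_in (A :|: B)) x z.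
  rewrite in_setU => /orP[xA|xB].
    by apply: (adj_in_sub (subsetUl A B)); apply: cA.
  by apply: (adj_in_sub (subsetUr A B)); apply: cB.
move=> x y /toz xz /toz yz; apply: connect_trans xz _.
by rewrite adj_in_sym.
Qed.

Lemma connected_pair x y : adj x y -> connected_set [set x; y].
Proof.
move=> axy s t; have xy : connect (adj_in [set x; y]) x y.
  by apply: connect1; rewrite /adj_in !inE !eqxx orbT.
by rewrite !inE => /orP[/eqP->|/eqP->] /orP[/eqP->|/eqP->]; rewrite ?connect0 // adj_in_sym.
Qed.

Lemma connected_neighbor S x : connected_set S -> (2 <= #|S|)%N -> x \in S ->
  exists2 y, y \in S & adj x y.
Proof.
move=> cS S2 xS; have [y yS yx] : exists2 y, y \in S & y != x.
  have : S :\ x != set0 by rewrite -card_gt0; move: S2; rewrite (cardsD1 x) xS.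
  by case/set0Pn=> y /setD1P[yx yS]; exists y.
have /connectP[[|z p]] /= := cS x y xS yS; first by move=> _ e; rewrite e eqxx in yx.
by case/andP=> /and3P[_ zS axz] _ _; exists z.
Qed.

Variable r : G -> nat.
Hypothesis elim_r : elimination_order r.

(** A path can bypass the last vertex v, since the two neighbours of v on the
    path are adjacent. *)
Lemma connected_setD1 S v : connected_set S -> v \in S ->
  (forall y, y \in S -> (r y <= r v)%N) -> connected_set (S :\ v).
Proof.
have [r_inj r_elim] := elim_r => cS vS top x y /setD1P[xv xS] /setD1P[yv yS].
have ltr z : z \in S -> z != v -> (r z < r v)%N.
  move=> zS zv; rewrite ltn_neqAle top // andbT.
  by apply: contra zv => /eqP/r_inj->.
have /connectP[p] := cS x y xS yS.
have [k] := ubnP (size p); elim: k p x xv xS => // k IH [|z p] x xv xS /=; first by move=> _ _ ->.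
rewrite ltnS => pk /andP[/and3P[_ zS axz] pth] yE.
have [zv|zv] := eqVneq z v; last first.
  apply: connect_trans (IH p z zv zS pk pth yE); apply: connect1.
  by rewrite /adj_in !inE xv xS zv zS.
rewrite zv in axz pth yE; case: p pk pth yE => [|t p] pk /=.
  by move=> _ yE; rewrite yE eqxx in yv.
case/andP=> /and3P[_ tS avt] pth yE.
have tv : t != v by apply: contraTneq avt => ->; rewrite adj_irrefl.
have ctk : connect (adj_in (S :\ v)) t y by apply: (IH p t); rewrite // ltnW.
have [->//|xt] := eqVneq x t; apply: connect_trans ctk; apply: connect1.
by rewrite /adj_in !inE xv xS tv tS (r_elim v) // ?ltr // adj_sym.
Qed.

Lemma connected_initial S k : connected_set S -> connected_set [set u in S | (r u <= k)%N].
Proof.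
have [j] := ubnP #|S|; elim: j S => // j IH S; rewrite ltnS => Sj cS.
have [->|S0] := eqVneq S set0; first by move=> x y; rewrite !inE.
have [v vS vmax] : exists2 v, v \in S & forall y, y \in S -> (r y <= r v)%N.
  by case/set0Pn: S0 => v0 v0S; case: (arg_maxnP r v0S) => v; exists v.
have [vk|vk] := leqP (r v) k.
  suff -> : [set u in S | (r u <= k)%N] = S by [].
  apply/setP => u; rewrite inE; case: (boolP (u \in S)) => //= uS.
  exact: leq_trans (vmax u uS) vk.
have -> : [set u in S | (r u <= k)%N] = [set u in S :\ v | (r u <= k)%N].
  apply/setP => u; rewrite !inE; case: eqVneq => //= ->.
  by rewrite leqNgt vk andbF.
apply: IH; last exact: connected_setD1.
by apply: leq_trans Sj; rewrite [X in (_ < X)%N](cardsD1 v) vS.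
Qed.

End ConnectedSets.

Local Open Scope ring_scope.

(** * Connected flats as connected vertex sets *)

Section InducedFlats.
Variable G : sgraph.
Implicit Types (S W A B : {set G}) (u v w x y : G) (F : flat (graphic_matroid G)).

Definition induced_edges S : {set {set G}} := [set e in edges G | e \subset S].

Lemma induced_link S x y : link (induced_edges S) x y = adj_in S x y.
Proof.
rewrite /link inE -[_ \in edges G]/(link (edges G) x y) link_edges.
by rewrite subUset !sub1set andbC -andbA.
Qed.

Lemma induced_connect S x y : connect (link (induced_edges S)) x y = connect (adj_in S) x y.
Proof. by apply: eq_connect => u v; apply: induced_link. Qed.

Lemma induced_is_flat S : is_flat (graphic_matroid G) (induced_edges S).
Proof.
apply/graphic_flatP => [|x y axy cxy]; first by apply/subsetP => e; rewrite inE => /andP[].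
have nxy := adj_neq axy.
have inS u v : connect (link (induced_edges S)) u v -> u != v -> u \in S.
  case/connectP=> -[|z p] /=; first by move=> _ ->; rewrite eqxx.
  by rewrite induced_link => /andP[/andP[]].
rewrite -[_ \in _]/(link _ x y) induced_link /adj_in axy (inS x y) //=.
by rewrite (inS y x) // 1?connect_link_sym // eq_sym.
Qed.

Definition induced_flat S : flat (graphic_matroid G) := Flat (induced_is_flat S).

Lemma cover_induced S : connected_set S -> (2 <= #|S|)%N -> cover (induced_edges S) = S.
Proof.
move=> cS S2; apply/eqP; rewrite eqEsubset; apply/andP; split.
  by apply/bigcupsP => e; rewrite inE => /andP[].
apply/subsetP => x xS; have [y yS axy] := connected_neighbor cS S2 xS.
have : link (induced_edges S) x y by rewrite induced_link /adj_in xS yS.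
by case/link_cover/andP.
Qed.

Lemma induced_flat_connected S : connected_set S -> (2 <= #|S|)%N ->
  induced_flat S \in connected_flats G.
Proof.
move=> cS S2; rewrite inE; apply/andP; split.
  have /card_gt0P[x xS] : (0 < #|S|)%N by apply: leq_trans S2.
  have [y yS axy] := connected_neighbor cS S2 xS.
  apply/set0Pn; exists [set x; y]; rewrite -[_ \in _]/(link (induced_edges S) x y).
  by rewrite induced_link /adj_in xS yS.
rewrite /edge_connected /= cover_induced //.
apply/forall_inP => x xS; apply/forall_inP => y yS.
by rewrite induced_connect; apply: cS.
Qed.

Section ConnectedFlat.
Variable F : flat (graphic_matroid G).
Hypothesis F_conn : F \in connected_flats G.

Lemma connected_flat_link x y : link F x y = adj_in (cover F) x y.
Proof.
move: F_conn; rewrite inE => /andP[_ /forall_inP cF].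
apply/idP/and3P => [Fxy|[xF yF axy]].
  by have /andP[-> ->] := link_cover Fxy; rewrite (flat_link_adj Fxy).
by apply: flat_linkP => //; have /forall_inP := cF x xF; apply.
Qed.

Lemma connected_flat_induced : F = induced_flat (cover F).
Proof.
apply: val_inj; apply/setP => e; rewrite [RHS]inE; apply/idP/andP.
  by move=> eF; rewrite (subsetP (flat_edges F)) // bigcup_sup.
case=> /edgesP[x [y [axy ->]]] sF; rewrite -[_ \in _]/(link F x y) connected_flat_link.
by rewrite /adj_in axy !(subsetP sF) // !inE eqxx ?orbT.
Qed.

Lemma cover_connected : connected_set (cover F).
Proof.
move: (F_conn); rewrite inE => /andP[_ /forall_inP cF] x y xF yF.
rewrite -(eq_connect connected_flat_link).
by have /forall_inP := cF x xF; apply.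
Qed.

Lemma cover_card : (2 <= #|cover F|)%N.
Proof.
move: (F_conn); rewrite inE => /andP[/set0Pn[e eF] _].
rewrite -(edges_card2 (subsetP (flat_edges F) e eF)).
by apply: subset_leq_card; apply: bigcup_sup.
Qed.

End ConnectedFlat.

Lemma induced_le S W : connected_set S -> (2 <= #|S|)%N ->
  (induced_flat S <= induced_flat W)%O = (S \subset W).
Proof.
move=> cS S2; rewrite flat_leE; apply/idP/idP => [/subsetP sSW|SW]; last first.
  by apply/subsetP => e; rewrite !inE => /andP[-> /subset_trans->].
apply/subsetP => x xS; have [y yS axy] := connected_neighbor cS S2 xS.
have := sSW [set x; y]; rewrite -![_ \in _]/(link (induced_edges _) x y) !induced_link.
by rewrite /adj_in xS yS axy => /(_ isT) /and3P[].
Qed.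

Notation FB := (graph_building_set G).
Notation N := #|FB|.

(** A connected flat consists of all the edges between its vertices, so that
    the order, the atoms and the joins of intersecting connected flats can be
    read on vertex sets. *)
Definition flat_vertices (i : 'I_N) : {set G} := cover (enum_val i : flat (graphic_matroid G)).

Lemma index_connected (i : 'I_N) : enum_val i \in connected_flats G.
Proof. exact: (enum_valP i). Qed.

Lemma flat_vertices_connected i : connected_set (flat_vertices i).
Proof. exact: (cover_connected (index_connected i)). Qed.

Lemma flat_vertices_card i : (2 <= #|flat_vertices i|)%N.
Proof. exact: (cover_card (index_connected i)). Qed.

Lemma flat_vertices_induced i : enum_val i = induced_flat (flat_vertices i).
Proof. exact: (connected_flat_induced (index_connected i)). Qed.

Lemma flat_vertices_inj : injective flat_vertices.
Proof. by move=> i j e; apply: enum_val_inj; rewrite !flat_vertices_induced e. Qed.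

Lemma flat_vertices_surj S : connected_set S -> (2 <= #|S|)%N -> exists i, flat_vertices i = S.
Proof.
move=> cS S2; have iF : induced_flat S \in FB by apply: induced_flat_connected.
exists (enum_rank_in iF (induced_flat S)).
by rewrite /flat_vertices enum_rankK_in // cover_induced.
Qed.

Lemma flat_vertices_le i j : (enum_val i <= enum_val j)%O = (flat_vertices i \subset flat_vertices j).
Proof.
rewrite !flat_vertices_induced induced_le //; [exact: flat_vertices_connected|exact: flat_vertices_card].
Qed.

Lemma flat_vertices_atom i : is_atom (enum_val i) = (#|flat_vertices i| == 2)%N.
Proof.
have ci := @flat_vertices_connected i; have c2 := flat_vertices_card i.
apply/idP/idP => [/andP[lt0 /forallP at_i]|].
  have /card_gt0P[x xi] : (0 < #|flat_vertices i|)%N by apply: leq_trans c2.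
  have [y yi axy] := connected_neighbor ci c2 xi.
  have cxy := connected_pair axy.
  have xy2 : #|[set x; y]| = 2%N by rewrite cards2 adj_neq.
  have := at_i (induced_flat [set x; y]).
  rewrite flat_vertices_induced induced_le ?xy2 // subUset !sub1set xi yi andbT.
  have -> : (\bot < induced_flat [set x; y])%O.
    rewrite lt_def le0x andbT; have := induced_flat_connected cxy.
    rewrite xy2 inE => /(_ isT)/andP[+ _]; apply: contraNneq => ->.
    by rewrite flat_bot_set0.
  by move/eqP/(congr1 (fun F : flat _ => #|cover F|)); rewrite /= !cover_induced ?xy2 // => <-.
move/eqP=> i2; apply/andP; split.
  rewrite lt_def le0x andbT; have := index_connected i.
  by rewrite inE => /andP[+ _]; apply: contraNneq => ->; rewrite flat_bot_set0.
apply/forallP => Y; apply/implyP => /andP[Y0 Yi]; rewrite eq_le Yi /=.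
have [e eY] : exists e, e \in (Y : {set _}).
  apply/set0Pn; apply: contraTneq Y0 => Y0.
  suff -> : Y = \bot%O by rewrite ltxx.
  by apply: val_inj; rewrite -[RHS]/(flat_set (\bot%O : flat (graphic_matroid G))) flat_bot_set0.
move: Yi; rewrite flat_vertices_induced !flat_leE => Yi.
have uniq_e f : f \in induced_edges (flat_vertices i) -> f = flat_vertices i.
  rewrite inE => /andP[fE fi]; apply/eqP; rewrite eqEcard fi i2.
  by rewrite (edges_card2 fE).
apply/subsetP => f /uniq_e->; rewrite -(uniq_e e) //.
exact: (subsetP Yi).
Qed.

Lemma flat_vertices_join i j k : flat_vertices i :&: flat_vertices j != set0 ->
  flat_vertices k = flat_vertices i :|: flat_vertices j ->
  (enum_val i `|` enum_val j)%O = enum_val k.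
Proof.
move=> ij ek; apply: le_anti; rewrite leUx !flat_vertices_le ek subsetUl subsetUr /=.
set K := (_ `|` _)%O.
have iK : (enum_val i <= K)%O by apply: leUl.
have jK : (enum_val j <= K)%O by apply: leUr.
rewrite flat_leE flat_vertices_induced; apply/subsetP => e; rewrite inE => /andP[/edgesP[x [y [axy ->]]]].
rewrite ek => sxy; apply: (flat_linkP axy).
have lK l u v : (enum_val l <= K)%O -> u \in flat_vertices l -> v \in flat_vertices l ->
    connect (link K) u v.
  move=> lK ul vl; have := flat_vertices_connected ul vl; rewrite -induced_connect.
  apply: sub_connect_link; move: lK; rewrite flat_vertices_induced flat_leE; exact.
have /set0Pn[z /setIP[zi zj]] := ij.
have toz u : u \in flat_vertices i :|: flat_vertices j -> connect (link K) u z.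
  by rewrite in_setU => /orP[ui|uj]; [apply: (lK i)|apply: (lK j)].
apply: connect_trans (toz x _) _; first by rewrite (subsetP sxy) ?set21.
by rewrite connect_link_sym toz // (subsetP sxy) ?set22.
Qed.

Lemma FY_pair_relation i j k : flat_vertices i :&: flat_vertices j != set0 ->
  flat_vertices k = flat_vertices i :|: flat_vertices j ->
  ('X_k - 'X_i) * ('X_k - 'X_j) \in @FY_ideal _ _ FB.
Proof.
move=> ij ek.
have zero : 0 \in @FY_ideal _ _ FB by apply/ideal_spanP; exists [::]; rewrite ?big_nil.
have [sij|nij] := boolP (flat_vertices i \subset flat_vertices j).
  have -> : k = j by apply: flat_vertices_inj; rewrite ek; apply/setUidPr.
  by rewrite subrr mulr0.
have [sji|nji] := boolP (flat_vertices j \subset flat_vertices i).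
  have -> : k = i by apply: flat_vertices_inj; rewrite ek; apply/setUidPl.
  by rewrite subrr mul0r.
have nij' : i != j by apply: contraNneq nij => ->.
rewrite -[X in X \in _](_ : \prod_(l in [set i; j]) ('X_k - 'X_l) = _); last first.
  by rewrite big_setU1 ?inE //= big_set1.
apply: ideal_span_gen; apply: FY_antichain.
  apply/forall_inP => a; rewrite !inE => /orP[/eqP->|/eqP->];
    apply/forall_inP => b; rewrite !inE => /orP[/eqP->|/eqP->]; rewrite ?eqxx ?implybT //;
    by rewrite flat_vertices_le ?(negbTE nij) ?(negbTE nji).
by rewrite big_setU1 ?inE //= big_set1 (flat_vertices_join ij ek).
Qed.

Lemma prod_sub_congr (R : comNzRingType) (I : finType) (P : {pred I}) (x y : R) (a : I -> R) :
  exists q, \prod_(i in P) (x - a i) = \prod_(i in P) (y - a i) + q * (x - y).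
Proof.
elim/big_rec2: _ => [|i p1 p2 _ [q ->]]; first by exists 0; rewrite mul0r addr0.
by exists (p1 + (x - a i) * q); ring.
Qed.

(** The members of A can be taken in such an order that each one meets the
    union of the previous ones: otherwise the edges of the join would be
    disconnected. If k indexes the union of the members taken so far, l its
    union with one more member j, then the pair relation of k and j allows to
    replace 'X_k by 'X_l in the relation already obtained, after multiplication
    by 'X_l - 'X_j. *)
Lemma antichain_relation_in (J : {pred FY_poly FB}) :
  0 \in J -> {in J &, forall p q, p + q \in J} -> (forall q p, p \in J -> q * p \in J) ->
  (forall i j k, flat_vertices i :&: flat_vertices j != set0 -> flat_vertices k = flat_vertices i :|: flat_vertices j ->
    ('X_k - 'X_i) * ('X_k - 'X_j) \in J) ->
  forall i (A : {set 'I_N}), (\join_(j in A) enum_val j)%O = enum_val i ->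
    \prod_(j in A) ('X_i - 'X_j) \in J.
Proof.
move=> J0 JD JM Jpair i A joinA.
have leA j : j \in A -> flat_vertices j \subset flat_vertices i.
  by move=> jA; rewrite -flat_vertices_le -joinA (joins_sup (fun j => enum_val j)).
pose P (kA : 'I_N * {set 'I_N}) := [&& kA.2 \subset A, flat_vertices kA.1 \subset flat_vertices i,
  [forall j in kA.2, flat_vertices j \subset flat_vertices kA.1] &
  \prod_(j in kA.2) ('X_kA.1 - 'X_j) \in J].
have [j0 j0A] : exists j, j \in A.
  apply/set0Pn; apply: contraTneq (index_connected i) => A0.
  by rewrite -joinA A0 big_set0 inE flat_bot_set0 eqxx.
have P0 : P (j0, [set j0]).
  rewrite /P /= sub1set j0A leA //= big_set1 subrr J0 andbT.
  by apply/forall_inP => j; rewrite inE => /eqP->.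
case: (arg_maxnP (fun kA : 'I_N * {set 'I_N} => #|flat_vertices kA.1|) P0) => -[k A'] /and4P[/= A'A ki /forall_inP A'k Jk] kmax.
have [[j jA /andP[jk njk]]|stop] := pselect (exists2 j, j \in A &
    (flat_vertices j :&: flat_vertices k != set0) && ~~ (flat_vertices j \subset flat_vertices k)).
  have [l lE] : exists l, flat_vertices l = flat_vertices j :|: flat_vertices k.
    apply: flat_vertices_surj; first by apply: connected_setU => //; apply: flat_vertices_connected.
    exact: leq_trans (flat_vertices_card j) (subset_leq_card (subsetUl _ _)).
  have jA' : j \notin A' by apply: contra njk; apply: A'k.
  suff /kmax /= : P (l, j |: A').
    rewrite leqNgt proper_card // properE lE subsetUr /=.
    by apply: contra njk; apply: subset_trans; apply: subsetUl.
  rewrite /P /= subUset sub1set jA A'A lE subUset leA // ki /=; apply/andP; split.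
    apply/forall_inP => a; rewrite !inE => /predU1P[->|aA']; first exact: subsetUl.
    exact: subset_trans (A'k a aA') (subsetUr _ _).
  rewrite big_setU1 //=; have [q ->] := prod_sub_congr (mem A') ('X_l) ('X_k) (fun a => 'X_a : FY_poly FB).
  by rewrite mulrDr; apply: JD; [apply: JM|rewrite mulrCA; apply: JM; apply: Jpair].
pose K := [set e in edges G | (e \subset flat_vertices k) || [disjoint e & flat_vertices k]].
have linkK x y : link K x y = adj x y && ((x \in flat_vertices k) == (y \in flat_vertices k)).
  rewrite /link inE -[_ \in edges G]/(link (edges G) x y) link_edges subUset !sub1set.
  rewrite -setI_eq0 setIUl setU_eq0 !setI_eq0 !disjoints1.
  by case: (x \in _); case: (y \in _).
have flK : is_flat (graphic_matroid G) K.
  apply/graphic_flatP => [|x y axy /connectP[p pth yE]].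
    by apply/subsetP => e; rewrite inE => /andP[].
  rewrite -[_ \in _]/(link K x y) linkK axy /=.
  elim: p x {axy} pth yE => [|z p IH] x /=; first by move=> _ ->.
  by rewrite linkK => /andP[/andP[_ /eqP->]]; apply: IH.
have iK : (enum_val i <= Flat flK)%O.
  rewrite -joinA; apply/joinsP => j jA; rewrite flat_leE flat_vertices_induced.
  apply/subsetP => e; rewrite !inE => /andP[-> ej] /=.
  have [d|m] := boolP [disjoint flat_vertices j & flat_vertices k].
    by rewrite (disjointWl ej d) orbT.
  apply/orP; left; apply: subset_trans ej _; apply/negPn/negP => njk.
  by apply: stop; exists j; rewrite // setI_eq0 m.
have eki : k = i.
  apply: flat_vertices_inj; apply/eqP; rewrite eqEsubset ki; apply/subsetP => y yi.
  apply/negPn/negP => nyk.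
  have /card_gt0P[x xk] : (0 < #|flat_vertices k|)%N by apply: leq_trans (flat_vertices_card k).
  have xi := subsetP ki x xk.
  have [u [v [/and3P[ui vi auv] uk vk]]] := connect_exit (P := mem (flat_vertices k)) (flat_vertices_connected xi yi) xk nyk.
  have : link K u v.
    apply: (subsetP iK); rewrite -[_ \in _]/(link (enum_val i) u v).
    by rewrite flat_vertices_induced induced_link /adj_in ui vi.
  by rewrite linkK [u \in _]uk [v \in _](negbTE vk) andbF.
rewrite -eki (big_setID A') /= (setIidPr A'A) mulrC JM //.
Qed.

End InducedFlats.

(** * Functionals on polynomials *)

Section MonomialFunctionals.
Variables (n : nat) (f : 'X_{1..n} -> int).
Implicit Types (m : 'X_{1..n}) (p q : {mpoly int[n]}).

Definition mon_eval p : int := \sum_(m <- msupp p) p@_m * f m.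

Lemma mon_evalwE k p : (msize p <= k)%N ->
  mon_eval p = \sum_(m : 'X_{1..n < k}) p@_m * f m.
Proof.
move=> le_pk; set I : subFinType _ := 'X_{1..n < k}.
rewrite /mon_eval (big_mksub I) ?msupp_uniq //=; first last.
  by move=> x /msize_mdeg_lt /leq_trans; apply.
by rewrite big_rmcond //= => j /memN_msupp_eq0 ->; rewrite mul0r.
Qed.

Lemma mon_eval_is_additive : {morph mon_eval : p q / p - q}.
Proof.
move=> p q /=; pose_big_enough i.
  rewrite !(@mon_evalwE i) // -sumrB; apply: eq_bigr => m _.
  by rewrite mcoeffB mulrBl.
by close.
Qed.

HB.instance Definition _ := GRing.isAdditive.Build {mpoly int[n]} int mon_eval
  mon_eval_is_additive.

Lemma mon_evalZ c p : mon_eval (c *: p) = c * mon_eval p.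
Proof.
pose_big_enough i.
  rewrite !(@mon_evalwE i) // mulr_sumr; apply: eq_bigr => m _.
  by rewrite mcoeffZ mulrA.
by close.
Qed.

Lemma mon_evalX m : mon_eval 'X_[m] = f m.
Proof. by rewrite /mon_eval msuppX big_seq1 mcoeffX eqxx mul1r. Qed.

Lemma mon_eval_mull p : (forall m, mon_eval ('X_[m] * p) = 0) -> forall q, mon_eval (q * p) = 0.
Proof.
move=> h q; rewrite [q]mpolyE mulr_suml raddf_sum big1 // => m _.
by rewrite /= -scalerAl mon_evalZ h mulr0.
Qed.

End MonomialFunctionals.

Section Words.
Variables (n : nat) (T : finType) (vs : 'I_n -> {set T}).
Implicit Types (m : 'X_{1..n}).

Definition word m : seq {set T} := flatten [seq nseq (m i) (vs i) | i <- enum 'I_n].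

Lemma count_word (P : pred {set T}) m : count P (word m) = (\sum_i P (vs i) * m i)%N.
Proof.
rewrite count_flatten -map_comp sumnE big_map big_enum /=.
by apply: eq_bigr => i _; rewrite count_nseq.
Qed.

Lemma word_addU (i : 'I_n) m : perm_eq (word (m + U_(i))%MM) (vs i :: word m).
Proof.
apply/permP => P; rewrite /= !count_word.
under eq_bigr => j _ do rewrite mnmDE mnm1E mulnDr.
rewrite big_split /= addnC; congr (_ + _)%N.
rewrite (bigD1 i) //= eqxx muln1 big1 ?addn0 // => j ji.
by rewrite eq_sym (negbTE ji) muln0.
Qed.

Variable phi : seq {set T} -> bool.
Hypothesis phiF : FY_functional phi.

Definition word_eval : {mpoly int[n]} -> int := mon_eval (fun m => (phi (word m))%:R).

HB.instance Definition _ := GRing.isAdditive.Build {mpoly int[n]} int word_eval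
  (mon_eval_is_additive (fun m => (phi (word m))%:R)).

Lemma word_eval_small i p : (#|vs i| <= 2)%N -> word_eval (p * 'X_i) = 0.
Proof.
move=> i2; apply: mon_eval_mull => m; rewrite -mpolyXD mon_evalX.
by rewrite (functional_perm phiF (word_addU i m)) (functional_small phiF).
Qed.

Lemma word_eval_pair i j k p : vs i :&: vs j != set0 -> vs k = vs i :|: vs j ->
  word_eval (p * (('X_k - 'X_i) * ('X_k - 'X_j))) = 0.
Proof.
move=> ij ek; apply: mon_eval_mull => m.
have e a b : mon_eval (fun m => (phi (word m))%:R) ('X_[m] * 'X_a * 'X_b) =
    (phi [:: vs a, vs b & word m])%:R.
  rewrite -!mpolyXD mon_evalX; congr (nat_of_bool _)%:R.
  rewrite (functional_perm phiF (word_addU b _)); apply: (functional_perm phiF).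
  apply: (@perm_trans _ (vs b :: vs a :: word m)); first by rewrite perm_cons word_addU.
  by apply/permP => P /=; rewrite addnCA.
have -> : 'X_[m] * (('X_k - 'X_i) * ('X_k - 'X_j)) =
    'X_[m] * 'X_k * 'X_k + 'X_[m] * 'X_i * 'X_j
    - ('X_[m] * 'X_k * 'X_i + 'X_[m] * 'X_k * 'X_j) :> {mpoly int[n]} by ring.
rewrite raddfB !raddfD /= !e -!natrD ek (functional_rel phiF (word m) ij).
by rewrite natrD -opprD subrr.
Qed.

End Words.

Section FYIdeal.
Variable G : sgraph.
Notation FB := (graph_building_set G).

(** The polynomials all of whose multiples are killed form an ideal, so it is
    enough to consider the atoms and the pair relations. *)
Lemma word_eval_FY_ideal (phi : seq {set G} -> bool) (p : FY_poly FB) :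
  FY_functional phi -> p \in @FY_ideal _ _ FB -> word_eval (@flat_vertices G) phi p = 0.
Proof.
move=> phiF pI.
pose J : {pred FY_poly FB} := fun p => `[< forall q, word_eval (@flat_vertices G) phi (q * p) = 0 >].
suff : p \in J by move/asboolP/(_ 1); rewrite mul1r.
have J0 : 0 \in J by apply/asboolP => q; rewrite mulr0 raddf0.
have JD : {in J &, forall p q, p + q \in J}.
  move=> a b /asboolP aJ /asboolP bJ; apply/asboolP => q.
  by rewrite mulrDr raddfD /= aJ bJ addr0.
have JM q a : a \in J -> q * a \in J.
  by move=> /asboolP aJ; apply/asboolP => b; rewrite mulrA; apply: aJ.
have Jpair i j k : flat_vertices i :&: flat_vertices j != set0 -> flat_vertices k = flat_vertices i :|: flat_vertices j ->
    ('X_k - 'X_i) * ('X_k - 'X_j) \in J.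
  by move=> ij ek; apply/asboolP => q; apply: word_eval_pair.
apply: (ideal_span_min _ J0 JD JM) pI => _ [i at_i|i A _ joinA].
  apply/asboolP => q; apply: word_eval_small => //.
  by move: at_i; rewrite flat_vertices_atom => /eqP->.
exact: antichain_relation_in joinA.
Qed.

End FYIdeal.

(** * Groebner bases from independent standard monomials *)

Section QuadraticGroebner.
Variable n : nat.
Implicit Types (m : 'X_{1..n}) (p q g : {mpoly int[n]}) (a b : 'I_n).

(** The degree-lexicographic order; a variable of smaller index is larger. *)
Definition mon_le : rel 'X_{1..n} := fun m1 m2 => (m1 <= m2)%O.

Lemma monomial_order_mon_le : monomial_order mon_le.
Proof.
split; rewrite /mon_le.
- exact: le_total.
- exact: le_anti.
- exact: le_trans.
- exact: le0x.
- by move=> m m1 m2; rewrite lemc_add2r.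
Qed.

Lemma lead_mon_mlead p : lead_mon mon_le p = mlead p.
Proof.
have [->|p0] := eqVneq p 0; first by rewrite /lead_mon msupp0 mlead0.
rewrite /lead_mon; set s := sort _ _.
have ms : mlead p \in s by rewrite mem_sort mlead_supp.
have st : sorted mon_le s by apply: sort_sorted; apply: le_total.
have le_last m : m \in s -> (m <= last 0%MM s)%O.
  move=> /(nthP 0%MM)[i si <-]; rewrite -nth_last.
  have tr : transitive mon_le by move=> ? ? ?; apply: le_trans.
  have rf : reflexive mon_le by move=> ?; apply: lexx.
  have s0 : (0 < size s)%N by apply: leq_ltn_trans si.
  apply: (sorted_leq_nth tr rf 0%MM st); rewrite ?inE ?prednK //.
  by rewrite -ltnS prednK.
apply: le_anti; rewrite le_last // andbT; apply: msupp_le_mlead.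
by rewrite -(mem_sort mon_le) -/s; case: (s) ms => //= x s' _; apply: mem_last.
Qed.

Definition below m p := forall m', m' \in msupp p -> (m' < m)%O.

Lemma belowD m p q : below m p -> below m q -> below m (p + q).
Proof. by move=> hp hq m' /msuppD_le; rewrite mem_cat => /orP[/hp|/hq]. Qed.

Lemma belowN m p : below m p -> below m (- p).
Proof. by move=> hp m'; rewrite (perm_mem (msuppN p)); apply: hp. Qed.

Lemma below0 m : below m 0.
Proof. by move=> m'; rewrite msupp0. Qed.

Lemma belowX m m' : (m' < m)%O -> below m 'X_[m'].
Proof. by move=> lt m''; rewrite msuppX inE => /eqP->. Qed.

Variables (I : {pred {mpoly int[n]}}) (bad : rel 'I_n) (g : 'I_n -> 'I_n -> {mpoly int[n]}).

Definition standard m : Prop := forall a b, bad a b -> ~~ (U_(a) + U_(b) <= m)%MM.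

Hypothesis I0 : 0 \in I.
Hypothesis ID : forall p q, p \in I -> q \in I -> p + q \in I.
Hypothesis IM : forall q p, p \in I -> q * p \in I.
Hypothesis gI : forall a b, bad a b -> g a b \in I.
Hypothesis g_lead : forall a b, bad a b -> below (U_(a) + U_(b)) (g a b - 'X_a * 'X_b).
Hypothesis standard_free : forall p, p \in I -> (forall m, m \in msupp p -> standard m) -> p = 0.

Let IZ c p : p \in I -> c *: p \in I.
Proof. by move=> pI; rewrite -mul_mpolyC; apply: IM. Qed.

Lemma reduce_sum p :
  (forall m, m \in msupp p -> exists2 q,
     (forall m', m' \in msupp q -> standard m' /\ (m' <= m)%O) & 'X_[m] - q \in I) ->
  exists2 q, (forall m', m' \in msupp q -> standard m' /\ exists2 m, m \in msupp p & (m' <= m)%O)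
    & p - q \in I.
Proof.
move=> h.
suff aux (s : seq 'X_{1..n}) : {subset s <= msupp p} -> exists2 q,
    (forall m', m' \in msupp q -> standard m' /\ exists2 m, m \in msupp p & (m' <= m)%O) &
    \sum_(m <- s) p@_m *: 'X_[m] - q \in I.
  by have [//|q hq qI] := aux (msupp p); exists q; rewrite // {1}[p]mpolyE.
elim: s => [|m s IH] sub.
  by exists 0; rewrite ?big_nil ?subr0 // => m'; rewrite msupp0.
have [q0 hq0 q0I] := h m (sub m (mem_head m s)).
have [|q hq qI] := IH; first by move=> x xs; apply: sub; rewrite in_cons xs orbT.
exists (p@_m *: q0 + q); last first.
  rewrite big_cons opprD addrACA ID // -scalerBr; exact: IZ.
move=> m' /msuppD_le; rewrite mem_cat => /orP[/msuppZ_le/hq0[sm' le]|/hq//].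
by split=> //; exists m => //; apply/sub/mem_head.
Qed.

Lemma reduce_monomial m : exists2 q,
  (forall m', m' \in msupp q -> standard m' /\ (m' <= m)%O) & 'X_[m] - q \in I.
Proof.
move: m; apply: (@ltmwf n (fun m => exists2 q,
  (forall m', m' \in msupp q -> standard m' /\ (m' <= m)%O) & 'X_[m] - q \in I)) => m IH.
have [st|nst] := pselect (standard m).
  exists 'X_[m]; last by rewrite subrr.
  by move=> m'; rewrite msuppX inE => /eqP->.
have [a [b [bab le]]] : exists a b, bad a b /\ (U_(a) + U_(b) <= m)%MM.
  apply: contrapT => h; apply: nst => a b bab; apply/negP => le.
  by apply: h; exists a, b.
set m0 := (m - (U_(a) + U_(b)))%MM.
have mE : m = (m0 + (U_(a) + U_(b)))%MM by rewrite submK.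
pose t := g a b - 'X_a * 'X_b.
have bt : below m ('X_[m0] * t).
  move=> m' /msuppM_le/allpairsP[[u v] /= [+ vt ->]].
  rewrite msuppX inE => /eqP->; rewrite mE ltmc_add2r; exact: g_lead vt.
have [q hq qI] := reduce_sum (fun m' mt => IH m' (bt m' mt)).
exists (- q) => [m'|].
  rewrite (perm_mem (msuppN q)) => /hq[st [m1 /bt lt le1]]; split=> //.
  exact: le_trans le1 (ltW lt).
have -> : 'X_[m] - - q = 'X_[m0] * g a b + (- 1) * ('X_[m0] * t - q).
  by rewrite mE !mpolyXD /t; ring.
by apply: ID; apply: IM => //; apply: gI.
Qed.

(** If the leading monomial of p were standard, reducing all the other terms of
    p would produce a nonzero element of I whose monomials are all standard. *)
Lemma lead_not_standard p : p \in I -> p != 0 ->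
  exists a b, bad a b /\ (U_(a) + U_(b) <= mlead p)%MM.
Proof.
move=> pI p0; apply: contrapT => h.
have st : standard (mlead p).
  by move=> a b bab; apply/negP => le; apply: h; exists a, b.
pose p' := p - p@_(mlead p) *: 'X_[mlead p].
have bp' : below (mlead p) p'.
  move=> m mp'; rewrite lt_neqAle; apply/andP; split.
    apply: contraTneq mp' => ->.
    by rewrite mcoeff_msupp mcoeffB mcoeffZ mcoeffX eqxx mulr1 subrr eqxx.
  have /msuppB_le := mp'; rewrite mem_cat => /orP[|/msuppZ_le].
    exact: msupp_le_mlead.
  by rewrite msuppX inE => /eqP->.
have [q hq qI] := reduce_sum (p := p') (fun m _ => reduce_monomial m).
pose r := p@_(mlead p) *: 'X_[mlead p] + q.
have rI : r \in I.
  have -> : r = p + (- 1) * (p' - q) by rewrite /r /p'; ring.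
  by apply: ID => //; apply: IM.
have : r@_(mlead p) != 0.
  rewrite mcoeffD mcoeffZ mcoeffX eqxx mulr1 (_ : q@_ _ = 0) ?addr0 ?mleadc_eq0 //.
  apply: memN_msupp_eq0; apply/negP => /hq[_ [m /bp' lt le]].
  by have := le_lt_trans le lt; rewrite ltxx.
rewrite (standard_free rI) ?mcoeff0 ?eqxx // => m /msuppD_le.
rewrite mem_cat => /orP[/msuppZ_le|/hq[]//].
by rewrite msuppX inE => /eqP->.
Qed.

Definition quadratic_basis : seq {mpoly int[n]} :=
  [seq g ab.1 ab.2 | ab : 'I_n * 'I_n <- enum [pred ab : 'I_n * 'I_n | bad ab.1 ab.2]].

Lemma quadratic_basisP q : reflect (exists a b, bad a b /\ q = g a b) (q \in quadratic_basis).
Proof.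
apply: (iffP mapP) => [[[a b]]|[a [b [bab ->]]]].
  by rewrite mem_enum /= => bab ->; exists a, b.
by exists (a, b); rewrite ?mem_enum.
Qed.

Lemma mlead_g a b : bad a b ->
  mlead (g a b) = (U_(a) + U_(b))%MM /\ (g a b)@_(U_(a) + U_(b))%MM = 1.
Proof.
move=> bab; have gE : g a b = 'X_[(U_(a) + U_(b))%MM] + (g a b - 'X_a * 'X_b).
  by rewrite mpolyXD addrC subrK.
have c1 : (g a b)@_(U_(a) + U_(b))%MM = 1.
  rewrite gE mcoeffD mcoeffX eqxx (_ : (g a b - _)@__ = 0) ?addr0 //.
  by apply: memN_msupp_eq0; apply/negP => /(g_lead bab); rewrite ltxx.
split=> //; apply: le_anti; apply/andP; split; last first.
  by apply: msupp_le_mlead; rewrite mcoeff_msupp c1.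
have g0 : g a b != 0 by apply: contra_eq_neq c1 => ->; rewrite mcoeff0.
have := mlead_supp g0; rewrite {2}gE => /msuppD_le; rewrite mem_cat => /orP[|].
  by rewrite msuppX inE => /eqP->.
by move/(g_lead bab)/ltW.
Qed.

Lemma quadratic_basis_groebner : is_groebner_basis mon_le I quadratic_basis.
Proof.
split=> [_ /quadratic_basisP[a [b [bab ->]]]|_ /quadratic_basisP[a [b [bab ->]]]|p pI].
- exact: gI.
- by rewrite /lead_coeff lead_mon_mlead; have [-> ->] := mlead_g bab.
have [->|p0] := eqVneq p 0.
  apply/ideal_spanP; exists [::] => //.
  by rewrite /lead_term /lead_coeff mcoeff0 scale0r big_nil.
have [a [b [bab le]]] := lead_not_standard pI p0.
apply/ideal_spanP.
pose m0 := (mlead p - (U_(a) + U_(b)))%MM.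
exists [:: (p@_(mlead p) *: 'X_[m0], lead_term mon_le (g a b))].
  move=> x; rewrite inE => /eqP-> /=; exists (g a b) => //.
  by apply/quadratic_basisP; exists a, b.
rewrite big_seq1 /= /lead_term /lead_coeff !lead_mon_mlead.
have [-> ->] := mlead_g bab.
by rewrite scale1r -scalerAl -mpolyXD submK.
Qed.

End QuadraticGroebner.

(** * Quadratic rewriting rules *)

Section VariableOrder.
Variables (G : sgraph) (r : G -> nat).
Implicit Types (A B C : {set G}).

(** The order on variables, largest first. A later last vertex has priority, so
    that, for A and B with the same last vertex and union U, the product h_A h_B
    is larger than the products of h_A, h_B and h_U with the generator of U
    minus its last vertex. For equal last vertices h_U must be smaller than h_A
    and h_B, so smaller sets have priority. *)
Definition var_ge : rel {set G} := fun A B =>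
  (top_rank r B < top_rank r A)%N || ((top_rank r A == top_rank r B) && (#|A| <= #|B|)%N).

Lemma var_ge_total : total var_ge.
Proof. by move=> A B; rewrite /var_ge; lia. Qed.

Lemma var_ge_trans : transitive var_ge.
Proof. by move=> B A C; rewrite /var_ge; lia. Qed.

End VariableOrder.

Section Relations.
Variables (G : sgraph) (r : G -> nat).
Hypothesis elim_r : elimination_order r.
Implicit Types (A B S U F X : {set G}).

Variables (n : nat) (var_set : 'I_n -> {set G}) (kernel : {pred {mpoly int[n]}}).
Variable gen : {set G} -> {mpoly int[n]}.
Implicit Types (a b : 'I_n).

Hypothesis var_set_inj : injective var_set.
Hypothesis var_set_card : forall a, (2 < #|var_set a|)%N.
Hypothesis var_set_connected : forall a, connected_set (var_set a).
Hypothesis var_order : forall a b, ~~ var_ge r (var_set b) (var_set a) ->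
  (U_(b)%MM < U_(a)%MM :> 'X_{1..n})%O.
Hypothesis gen_var : forall a, gen (var_set a) = 'X_a.
Hypothesis gen_cases : forall S, (exists2 a, var_set a = S & gen S = 'X_a) \/ gen S = 0.
Hypothesis gen_small : forall S, (#|S| <= 2)%N -> gen S = 0.
Hypothesis kernelD : forall p q, p \in kernel -> q \in kernel -> p + q \in kernel.
Hypothesis kernelM : forall q p, p \in kernel -> q * p \in kernel.
Hypothesis gen_relation : forall A B, connected_set A -> connected_set B ->
  (2 <= #|A|)%N -> (2 <= #|B|)%N -> A :&: B != set0 ->
  (gen (A :|: B) - gen A) * (gen (A :|: B) - gen B) \in kernel.

Notation non_standard := (non_standard r var_set).

Let r_inj : injective r := proj1 elim_r.

Lemma gen_homog S : gen S \is 1.-homog.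
Proof.
have [[a _ ->]|->] := gen_cases S; last exact: dhomog0.
by rewrite dhomogX /= mdeg1.
Qed.

Lemma genM_homog S S' : gen S * gen S' \is 2.-homog.
Proof. exact: (dhomogM (gen_homog S) (gen_homog S')). Qed.

Lemma below_genM_lt_le a b S S' : ~~ var_ge r S (var_set a) ->
  S' = var_set b \/ ~~ var_ge r S' (var_set b) -> below (U_(a) + U_(b)) (gen S * gen S').
Proof.
move=> Sa S'b; have [[c cS ->]|->] := gen_cases S; last by rewrite mul0r; apply: below0.
have [[d dS' ->]|->] := gen_cases S'; last by rewrite mulr0; apply: below0.
rewrite -mpolyXD; apply: belowX; rewrite -cS in Sa; rewrite -dS' in S'b.
apply: ltmc_le_add; first exact: var_order.
by case: S'b => [/var_set_inj->|/var_order/ltW].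
Qed.

Lemma below_genM_le_lt a b S S' : S = var_set a \/ ~~ var_ge r S (var_set a) ->
  ~~ var_ge r S' (var_set b) -> below (U_(a) + U_(b)) (gen S * gen S').
Proof. by move=> Sa S'b; rewrite addmC mulrC; apply: below_genM_lt_le. Qed.

Lemma top_rank_lt S k : S != set0 -> (forall y, y \in S -> (r y < k)%N) -> (top_rank r S < k)%N.
Proof. by move=> S0 hS; have [z zS <-] := top_rank_attained r S0; apply: hS. Qed.

Section Top.
Variables (U : {set G}) (v : G).
Hypotheses (cU : connected_set U) (vU : v \in U) (top : forall y, y \in U -> (r y <= r v)%N).
Hypothesis U3 : (2 < #|U|)%N.

Lemma top_lt y : y \in U -> y != v -> (r y < r v)%N.
Proof.
move=> yU yv; rewrite ltn_neqAle top // andbT.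
by apply: contra yv => /eqP/r_inj->.
Qed.

Lemma top_rank_topE : top_rank r U = r v.
Proof. exact: (top_rank_top top (subxx U) vU). Qed.

Lemma top_card : (2 <= #|U :\ v|)%N.
Proof. by move: U3; rewrite (cardsD1 v) vU. Qed.

Lemma top_connected : connected_set (U :\ v).
Proof. exact: (connected_setD1 elim_r cU vU top). Qed.

Lemma top_rank_top_remove : (top_rank r (U :\ v) < r v)%N.
Proof.
apply: top_rank_lt; first by rewrite -card_gt0 (leq_trans _ top_card).
by move=> y /setD1P[yv yU]; apply: top_lt.
Qed.

Lemma top_relation A : connected_set A -> v \in A -> A \subset U -> (2 <= #|A|)%N ->
  (gen U - gen (U :\ v)) * (gen U - gen A) \in kernel.
Proof.
move=> cA vA AU A2.
have UE : (U :\ v) :|: A = U.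
  apply/setP => y; rewrite !inE; case: eqVneq => [->|_] /=; first by rewrite vA vU.
  by case: (boolP (y \in A)) => [/(subsetP AU)->|]; rewrite ?orbF ?orbT.
have := @gen_relation (U :\ v) A; rewrite UE; apply=> //.
- exact: top_connected.
- exact: top_card.
- have : A :\ v != set0 by rewrite -card_gt0; move: A2; rewrite (cardsD1 v) vA.
  case/set0Pn=> y /setD1P[yv yA]; apply/set0Pn; exists y.
  by rewrite !inE yv yA (subsetP AU).
Qed.

(** U minus v and an edge at v cover U, and the generator of an edge is 0. *)
Lemma top_square : gen U * (gen U - gen (U :\ v)) \in kernel.
Proof.
have [y yU avy] := connected_neighbor cU (ltnW U3) vU.
have e2 : #|[set v; y]| = 2%N by rewrite cards2 adj_neq.
have := top_relation (connected_pair avy) (set21 _ _) _ _.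
rewrite e2 subUset !sub1set vU yU => /(_ isT isT).
have e0 : gen [set v; y] = 0 by apply: gen_small; rewrite e2.
by rewrite e0 subr0 [gen U * _]mulrC.
Qed.

End Top.

Definition rewriting_rule a b (g : {mpoly int[n]}) : Prop :=
  [/\ g \in kernel, g \is 2.-homog & below (U_(a) + U_(b)) (g - 'X_a * 'X_b)].

Lemma var_ge_top_rank A B : (top_rank r B < top_rank r A)%N -> ~~ var_ge r B A.
Proof. by rewrite /var_ge; lia. Qed.

Lemma var_ge_card A B : top_rank r A = top_rank r B -> (#|A| < #|B|)%N -> ~~ var_ge r B A.
Proof. by rewrite /var_ge; lia. Qed.

(** Write u, a, b, t for the generators of U, A, B and U minus its last vertex,
    where U is the union of A and B. The pair relations contain u u = t u,
    u a = t a and u b = t b, so a b = u a + u b - u u = t (a + b - u). *)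
Lemma same_top_rule a b : top_rank r (var_set a) = top_rank r (var_set b) -> exists g, rewriting_rule a b g.
Proof.
set A := var_set a; set B := var_set b => eAB.
have A3 : (2 < #|A|)%N := var_set_card a; have B3 : (2 < #|B|)%N := var_set_card b.
have cA : connected_set A := @var_set_connected a.
have cB : connected_set B := @var_set_connected b.
have A0 : A != set0 by rewrite -card_gt0 (leq_trans _ A3).
have B0 : B != set0 by rewrite -card_gt0 (leq_trans _ B3).
have [v vA vm] := top_rank_attained r A0.
have vB : v \in B by have [z zB zm] := top_rank_attained r B0; rewrite (_ : v = z) //; apply: r_inj; rewrite vm zm.
set U := A :|: B.
have AU : A \subset U := subsetUl _ _; have BU : B \subset U := subsetUr _ _.
have vU : v \in U by rewrite (subsetP AU).
have top y : y \in U -> (r y <= r v)%N.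
  by rewrite vm in_setU => /orP[|yB]; [apply: leq_top_rank|rewrite eAB leq_top_rank].
have AB : A :&: B != set0 by apply/set0Pn; exists v; rewrite inE vA.
have cU : connected_set U by apply: connected_setU.
have U3 : (2 < #|U|)%N := leq_trans A3 (subset_leq_card AU).
have mU : top_rank r U = r v by apply: top_rank_topE.
have mU' : (top_rank r (U :\ v) < r v)%N by apply: top_rank_top_remove.
have le_U c : var_set c \subset U -> top_rank r (var_set c) = r v ->
    U = var_set c \/ ~~ var_ge r U (var_set c).
  move=> cU' cm; have [->|ne] := eqVneq U (var_set c); first by left.
  right; apply: var_ge_card; first by rewrite mU.
  by apply: proper_card; rewrite properEneq cU' eq_sym ne.
pose u' := gen (U :\ v).
exists (gen A * gen B - (u' * gen A + u' * gen B - u' * gen U)); split.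
- have -> : gen A * gen B - (u' * gen A + u' * gen B - u' * gen U) =
     (gen U - gen A) * (gen U - gen B) + (-1) * ((gen U - u') * (gen U - gen A)) +
     (-1) * ((gen U - u') * (gen U - gen B)) + gen U * (gen U - u') by ring.
  have h1 : (gen U - gen A) * (gen U - gen B) \in kernel by apply: gen_relation => //; apply: ltnW.
  have h2 : (gen U - u') * (gen U - gen A) \in kernel by apply: top_relation => //; apply: ltnW.
  have h3 : (gen U - u') * (gen U - gen B) \in kernel by apply: top_relation => //; apply: ltnW.
  have h4 : gen U * (gen U - u') \in kernel by apply: top_square.
  apply: (kernelD _ h4); apply: kernelD; last exact: kernelM.
  by apply: (kernelD h1); apply: kernelM.
- by rewrite !(rpredB, rpredD) ?genM_homog.
- have -> : gen A * gen B - (u' * gen A + u' * gen B - u' * gen U) - 'X_a * 'X_b =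
      - (gen A * u' + u' * gen B - u' * gen U).
    by rewrite -(gen_var a) -(gen_var b) -/A -/B; ring.
  have ltU' c : top_rank r (var_set c) = r v -> ~~ var_ge r (U :\ v) (var_set c).
    by move=> cm; apply: var_ge_top_rank; rewrite cm.
  apply/belowN/belowD; [apply: belowD|apply: belowN].
  - by apply: below_genM_le_lt; [left|apply: ltU'; rewrite -eAB].
  - by apply: below_genM_lt_le; [apply: ltU'|left].
  - by apply: below_genM_lt_le; [apply: ltU'|apply: le_U; rewrite -?eAB].
Qed.

(** Write x, u, f for the generators of X, of U = X :|: F and of F. The pair
    relation of X and F is (u - x) f = (u - x) u, so (u - x) f does not change
    if F is replaced by the initial segment F0 of U. If U has only one vertex
    more than X, F can also be replaced by an edge that joins this vertex to X;
    the generator of the edge is 0, hence x f = u f. *)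
Lemma initial_rule a b : (top_rank r (var_set b) < top_rank r (var_set a))%N ->
  ~~ normal_pair r (var_set b) (var_set a) -> exists g, rewriting_rule a b g.
Proof.
set X := var_set a; set F := var_set b => ltFX.
rewrite /normal_pair ltFX /= => /norP[mFX /norP[nFX niFX]].
have X3 : (2 < #|X|)%N := var_set_card a; have F3 : (2 < #|F|)%N := var_set_card b.
have cX : connected_set X := @var_set_connected a.
have cF : connected_set F := @var_set_connected b.
have X0 : X != set0 by rewrite -card_gt0 (leq_trans _ X3).
have FX : F :&: X != set0 by rewrite setI_eq0.
have [v vX vm] := top_rank_attained r X0.
have [w wX w_min] := exists_bot r X0.
set U := X :|: F.
have XU : X \subset U := subsetUl _ _; have FU : F \subset U := subsetUr _ _.
have vU : v \in U by rewrite (subsetP XU).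
have ltF y : y \in F -> (r y < r v)%N.
  by move=> yF; rewrite vm (leq_ltn_trans _ ltFX) ?leq_top_rank.
have top y : y \in U -> (r y <= r v)%N.
  by rewrite in_setU => /orP[yX|/ltF/ltnW//]; rewrite vm leq_top_rank.
have cU : connected_set U by apply: connected_setU; rewrite // setIC.
have U3 : (2 < #|U|)%N := leq_trans X3 (subset_leq_card XU).
have mU : top_rank r U = r v by apply: top_rank_topE.
have vF : v \notin F by apply/negP => /ltF; rewrite ltnn.
have wv : w != v.
  have : X :\ v != set0 by rewrite -card_gt0 (leq_trans _ (top_card vX X3)).
  case/set0Pn=> y /setD1P[yv yX]; apply: contra_neq yv => wv.
  by apply: r_inj; apply/eqP; rewrite eqn_leq vm leq_top_rank // -vm -wv w_min.
set D := F :\: X.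
have D0 : D != set0 by rewrite setD_eq0.
have XltU : ~~ var_ge r U X.
  apply: var_ge_card; first by rewrite mU vm.
  apply: proper_card; rewrite properE XU /=; apply: contra nFX.
  exact: subset_trans FU.
have rel (F1 : {set G}) : connected_set F1 -> (2 <= #|F1|)%N -> F1 :&: X != set0 -> X :|: F1 = U ->
    (gen U - gen X) * (gen U - gen F1) \in kernel.
  move=> c1 c2 m1 <-; rewrite setIC in m1; apply: gen_relation => //; exact: ltnW.
have relF := rel F cF (ltnW F3) FX erefl.
have [D1|D2] := leqP #|D| 1.
  have [d dD] := set0Pn _ D0.
  have [dX dF] : d \notin X /\ d \in F by move: dD; rewrite inE => /andP.
  have [y yU ady] := connected_neighbor cU (ltnW U3) (subsetP FU d dF).
  have uniqD z : z \in U -> z != d -> z \in X.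
    rewrite in_setU => /orP[//|zF] zd; apply/negPn/negP => zX.
    have : (#|[set z; d]| <= #|D|)%N.
      apply/subset_leq_card/subsetP => t; rewrite !inE => /orP[/eqP->|/eqP->].
        by rewrite zX.
      by rewrite dX.
    by rewrite cards2 zd leqNgt ltnS D1.
  have yd : y != d by rewrite eq_sym adj_neq.
  have yX := uniqD y yU yd.
  have e2 : #|[set d; y]| = 2%N by rewrite cards2 eq_sym yd.
  have UE : X :|: [set d; y] = U.
    apply/setP => z; rewrite !inE; case: (eqVneq z d) => [->|zd] /=.
      by rewrite dF orbT.
    case: (eqVneq z y) => [->|_] /=; first by rewrite yX.
    by rewrite orbF; apply/idP/orP => [|zU]; [left|apply: uniqD => //; rewrite inE; apply/orP].
  have relE : (gen U - gen X) * gen U \in kernel.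
    have := rel [set d; y] (connected_pair ady) _ _ UE; rewrite e2.
    have -> : gen [set d; y] = 0 by apply: gen_small; rewrite e2.
    by rewrite subr0; apply=> //; apply/set0Pn; exists y; rewrite !inE eqxx orbT.
  exists (gen X * gen F - gen U * gen F); split.
  - have -> : gen X * gen F - gen U * gen F = (gen U - gen X) * (gen U - gen F) + (-1) * ((gen U - gen X) * gen U) by ring.
    by apply: kernelD => //; apply: kernelM.
  - by rewrite rpredB ?genM_homog.
  - have -> : gen X * gen F - gen U * gen F - 'X_a * 'X_b = - (gen U * gen F).
      by rewrite -(gen_var a) -(gen_var b) -/X -/F; ring.
    by apply: belowN; apply: below_genM_lt_le => //; left.
(* The lowest threshold that keeps U minus X and one vertex of X. *)
set k := maxn (top_rank r D) (r w).
set F0 := [set u in U :\ v | (r u <= k)%N].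
have wU' : w \in U :\ v by rewrite !inE wv wX.
have wF0 : w \in F0 by rewrite inE wU' leq_maxr.
have DF0 : D \subset F0.
  apply/subsetP => d dD; have := dD; rewrite inE => /andP[dX dF].
  rewrite !inE (leq_trans (leq_top_rank r dD) (leq_maxl _ _)) dF orbT andbT andbT.
  by apply: contraNneq dX => ->.
have UE : X :|: F0 = U.
  apply/eqP; rewrite eqEsubset subUset XU /=; apply/andP; split.
    by apply/subsetP => z; rewrite inE => /andP[/setD1P[]].
  apply/subsetP => z; rewrite [_ \in U]in_setU => /orP[zX|zF]; rewrite in_setU ?zX //.
  by case: (boolP (z \in X)) => //= zX; apply: (subsetP DF0); rewrite inE zX.
have cF0 : connected_set F0 by apply: connected_initial => //; apply: top_connected.
have F0X : F0 :&: X != set0 by apply/set0Pn; exists w; rewrite inE wF0.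
have F03 : (2 < #|F0|)%N.
  apply: leq_trans (_ : #|w |: D| <= _)%N; last by apply: subset_leq_card; rewrite subUset sub1set wF0.
  by rewrite cardsU1 inE wX /= add1n ltnS.
have relF0 := rel F0 cF0 (ltnW F03) F0X UE.
have kF : (k <= top_rank r F)%N.
  rewrite geq_max top_rank_sub ?subsetDl //=.
  by have /set0Pn[y /setIP[yF yX]] := FX; apply: leq_trans (w_min y yX) (leq_top_rank r yF).
have mF0 : (top_rank r F0 <= k)%N.
  by apply/bigmax_leqP => y; rewrite inE => /andP[].
have FF0 : F != F0.
  apply: contraNneq niFX => eF; have mF : top_rank r F = k.
    by apply/eqP; rewrite eqn_leq kF eF mF0.
  apply/initialP; split=> //.
  - move=> x xX xk; rewrite eF inE -mF xk andbT !inE xX andbT.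
    by apply: contraTneq xk => ->; rewrite -ltnNge vm.
  - have [le|lt] := leqP (top_rank r D) (r w).
      right=> x xF xX; apply/eqP; rewrite eqn_leq leq_top_rank //.
      by rewrite mF /k (maxn_idPr le) w_min.
    left=> x xF xX; rewrite ltn_neqAle leq_top_rank // andbT mF /k (maxn_idPl (ltnW lt)).
    have [d dD <-] := top_rank_attained r D0; apply: contraTneq xX => /r_inj->.
    by move: dD; rewrite inE => /andP[].
have F0ltF : ~~ var_ge r F0 F.
  have [lt|le] := ltnP (top_rank r F0) (top_rank r F); first exact: var_ge_top_rank.
  have mF : top_rank r F = k by apply/eqP; rewrite eqn_leq kF (leq_trans le mF0).
  apply: var_ge_card; first by apply/eqP; rewrite eqn_leq le mF mF0.
  apply: proper_card; rewrite properEneq FF0; apply/subsetP => y yF.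
  rewrite inE -mF leq_top_rank // andbT !inE yF orbT andbT.
  by apply: contraNneq vF => <-.
exists (gen X * gen F - gen X * gen F0 - gen U * gen F + gen U * gen F0); split.
- have -> : gen X * gen F - gen X * gen F0 - gen U * gen F + gen U * gen F0 =
    (gen U - gen X) * (gen U - gen F) + (-1) * ((gen U - gen X) * (gen U - gen F0)) by ring.
  by apply: kernelD => //; apply: kernelM.
- by rewrite !(rpredB, rpredD) ?genM_homog.
- have -> : gen X * gen F - gen X * gen F0 - gen U * gen F + gen U * gen F0 - 'X_a * 'X_b =
      - (gen X * gen F0) - gen U * gen F + gen U * gen F0.
    by rewrite -(gen_var a) -(gen_var b) -/X -/F; ring.
  apply: belowD; first apply: belowD.
  - by apply: belowN; apply: below_genM_le_lt => //; left.
  - by apply: belowN; apply: below_genM_lt_le => //; left.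
  - by apply: below_genM_lt_le => //; right.
Qed.

Lemma rewriting_rule_exists a b : non_standard a b -> exists g, rewriting_rule a b g.
Proof.
move=> ns; have [eab|lt|lt] := ltngtP (top_rank r (var_set a)) (top_rank r (var_set b)); last exact: same_top_rule.
  have nab : ~~ normal_pair r (var_set a) (var_set b).
    case/orP: ns => [/eqP e|/norP[]//]; by rewrite e ltnn in eab.
  have [g [gK gh gb]] := initial_rule eab nab; exists g; split=> //.
  by rewrite addmC mulrC.
apply: (initial_rule lt); case/orP: ns => [/eqP e|/norP[]//].
by rewrite e ltnn in lt.
Qed.

End Relations.

(** * Independence of standard monomials *)

Section StandardFree.
Variables (T : finType) (r : T -> nat).
Hypothesis r_inj : injective r.
Variables (n : nat) (var_set : 'I_n -> {set T}) (kernel : {pred {mpoly int[n]}}).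
Implicit Types (a b : 'I_n) (m : 'X_{1..n}) (p : {mpoly int[n]}).

Hypothesis var_set_inj : injective var_set.
Hypothesis var_set_card : forall a, (2 < #|var_set a|)%N.
Hypothesis kernel_eval : forall phi p, FY_functional phi -> p \in kernel ->
  word_eval var_set phi p = 0.

Notation bad := (non_standard r var_set).

Definition monomial_family m : {set {set T}} := var_set @: [set a | m a != 0%N].

Lemma mem_monomial_family m a : (var_set a \in monomial_family m) = (m a != 0%N).
Proof. by rewrite mem_imset // inE. Qed.

Lemma lem_U2 a b m : (a != b -> (0 < m a)%N /\ (0 < m b)%N) -> (a = b -> (1 < m a)%N) ->
  (U_(a) + U_(b) <= m)%MM.
Proof.
move=> h1 h2; apply/mnm_lepP => i; rewrite mnmDE !mnm1E.
case: (eqVneq a b) h1 h2 => [<- _ /(_ erefl)|ab /(_ isT)[ma mb] _]; case: eqVneq => [<-|_] //.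
  by rewrite eq_sym (negbTE ab).
by case: eqVneq => [<-|].
Qed.

Lemma standard_squarefree m a : standard bad m -> (m a <= 1)%N.
Proof.
move=> st; rewrite leqNgt; apply: contra (st a a _); last by rewrite /non_standard eqxx.
by move=> ma; apply: lem_U2; rewrite ?eqxx.
Qed.

Lemma standard_family m : standard bad m -> monomial_family m \in normal_families r [set: T].
Proof.
move=> st; apply/normal_familiesP; split=> [F /imsetP[a _ ->]|F X /imsetP[a am ->] /imsetP[b bm ->]].
  by rewrite subsetT var_set_card.
rewrite !inE -!lt0n in am bm * => ab; apply/orP/negPn/negP => nab.
have /negP[] : ~~ (U_(a) + U_(b) <= m)%MM by apply: st; rewrite /non_standard nab orbT.
by apply: lem_U2 => // e; rewrite e eqxx in ab.
Qed.

Lemma family_inj m m' : standard bad m -> standard bad m' -> monomial_family m = monomial_family m' -> m = m'.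
Proof.
move=> st st' e; apply/mnmP => a.
have := mem_monomial_family m a; rewrite e mem_monomial_family.
have := standard_squarefree a st; have := standard_squarefree a st'; lia.
Qed.

Lemma word_family m : standard bad m -> perm_eq (word var_set m) (enum (monomial_family m)).
Proof.
move=> st; apply: (@perm_trans _ [seq var_set a | a <- enum [set a | m a != 0%N]]).
  apply/permP => P; rewrite count_word count_map -sum1_count big_enum_cond /=.
  rewrite [RHS]big_mkcond /=; apply: eq_bigr => a _; rewrite inE.
  have := standard_squarefree a st; case: (m a) => [|[|//]] _ /=; rewrite ?muln0 ?muln1 //.
apply: uniq_perm; first by rewrite map_inj_uniq // enum_uniq.
  by rewrite enum_uniq.
move=> S; rewrite mem_enum; apply/mapP/imsetP => -[a am ->]; exists a => //.
  by rewrite mem_enum in am.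
by rewrite mem_enum.
Qed.

(** A standard monomial is squarefree, its factors form a normal family, and it
    is determined by this family. *)
Lemma standard_monomials_free p : p \in kernel ->
  (forall m, m \in msupp p -> standard bad m) -> p = 0.
Proof.
move=> pK st.
pose c fam : int := \sum_(m <- msupp p | monomial_family m == fam) p@_m.
have c0 : {in normal_families r [set: T], forall fam, c fam = 0}.
  apply: (normal_separated r_inj) => f [Phi ePhi fE].
  have fPhi : FY_functional (Phi set0).
    by apply: (extendable_functional ePhi); rewrite -setI_eq0 set0I.
  rewrite -[RHS](kernel_eval fPhi pK) /word_eval /mon_eval.
  under eq_bigr => fam _ do rewrite /c mulr_suml.
  rewrite (exchange_big_dep predT) //= [LHS]big_seq [RHS]big_seq; apply: eq_bigr => m mp.
  rewrite (big_pred1 (monomial_family m)) => [|fam].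
    rewrite fE; congr (_ * (nat_of_bool _)%:R).
    by apply/esym/(functional_perm fPhi)/word_family/st.
  by apply/andP/eqP => [[_ /eqP->]//|->]; rewrite standard_family ?eqxx //; apply: st.
apply/eqP; rewrite -msupp_eq0; apply/eqP/nilP/negPn/negP => ne.
have [m mp] : exists m, m \in msupp p by case: (msupp p) ne => // m s _; exists m; apply: mem_head.
have := c0 _ (standard_family (st m mp)).
rewrite /c big_mkcond (bigD1_seq m) ?msupp_uniq //= eqxx.
rewrite big1_seq ?addr0 => [/eqP|m' /andP[ne' mp']]; first by rewrite mcoeff_eq0 mp.
case: ifP => // /eqP e; by rewrite (family_inj (st m' mp') (st m mp) e) eqxx in ne'.
Qed.

End StandardFree.

(** * The presentation of the Feichtner-Yuzvinsky ring *)

Section Presentation.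
Variables (G : sgraph) (r : G -> nat).
Implicit Types (A B S U F X : {set G}).
Notation FB := (graph_building_set G).
Notation N := #|FB|.

(** The list is decreasing, to agree with mon_le. Atoms are left out since
    their generators vanish in the ring. *)
Definition variables : seq 'I_N :=
  sort (relpre (@flat_vertices G) (var_ge r)) [seq i <- enum 'I_N | (2 < #|flat_vertices i|)%N].

Notation n := (size variables).

Definition var_index (a : 'I_n) : 'I_N := tnth (in_tuple variables) a.
Definition var_set (a : 'I_n) : {set G} := flat_vertices (var_index a).

Lemma var_set_inj : injective var_set.
Proof.
move=> a b /flat_vertices_inj; rewrite /var_index.
by apply/tuple_uniqP; rewrite sort_uniq filter_uniq // enum_uniq.
Qed.

Lemma var_set_card a : (2 < #|var_set a|)%N.
Proof.
have := mem_tnth a (in_tuple variables).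
by rewrite mem_sort mem_filter => /andP[].
Qed.

Lemma var_set_connected a : connected_set (var_set a).
Proof. exact: flat_vertices_connected. Qed.

Lemma var_set_surj S : connected_set S -> (2 < #|S|)%N -> exists a, var_set a = S.
Proof.
move=> cS S2; have [i iS] := flat_vertices_surj cS (ltnW S2).
have : i \in variables by rewrite mem_sort mem_filter iS S2 mem_enum.
by move/(tnthP (in_tuple variables)) => [a ia]; exists a; rewrite /var_set /var_index -ia.
Qed.

Lemma var_order a b : ~~ var_ge r (var_set b) (var_set a) -> (U_(b)%MM < U_(a)%MM :> 'X_{1..n})%O.
Proof.
move=> nge.
have ab : (a < b)%N.
  rewrite ltnNge; apply: contra nge => ba.
  have st : sorted (relpre (@flat_vertices G) (var_ge r)) variables.
    by apply: sort_sorted => i j; apply: var_ge_total.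
  have tr : transitive (relpre (@flat_vertices G) (var_ge r)).
    by move=> ? ? ?; apply: var_ge_trans.
  have rf : reflexive (relpre (@flat_vertices G) (var_ge r)).
    by move=> i; rewrite /= /var_ge eqxx leqnn orbT.
  have nthE (c : 'I_n) : nth (var_index a) variables c = var_index c by rewrite -[LHS](tnth_nth _ (in_tuple variables)).
  have := sorted_leq_nth tr rf (var_index a) st b a (ltn_ord b) (ltn_ord a) ba.
  by rewrite !nthE.
apply/ltmcP; first by rewrite !mdeg1.
exists a => [j ja|]; rewrite !mnm1E ?eqxx.
  by rewrite -!val_eqE /= (gtn_eqF ja) (gtn_eqF (ltn_trans ja ab)).
by rewrite -val_eqE /= gtn_eqF.
Qed.

Definition generator_images : n.-tuple (FY_poly FB) := [tuple 'X_(var_index a) | a < n].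

Notation lift_poly := (comp_mpoly generator_images).

Definition presentation : {rmorphism {mpoly int[n]} -> FY FB} :=
  (\pi_{ideal_quot (@FY_ideal _ _ FB)} : {rmorphism FY_poly FB -> FY FB}) \o lift_poly.

Definition kernel : {pred {mpoly int[n]}} := fun p => presentation p == 0.

Lemma pi_FY_eq0 (p : FY_poly FB) : (\pi_(FY FB) p == 0) = (p \in @FY_ideal _ _ FB).
Proof.
rewrite -{2}[p]subr0 Quotient.idealrBE.
have -> : \pi_{ideal_quot (@FY_ideal _ _ FB)} 0 = 0 :> FY FB by exact: rmorph0.
by [].
Qed.

Lemma kernelE p : (p \in kernel) = (lift_poly p \in @FY_ideal _ _ FB).
Proof. exact: pi_FY_eq0. Qed.

Lemma lift_var a : lift_poly 'X_a = 'X_(var_index a).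
Proof.
by rewrite comp_mpolyXU -tnth_nth tnth_mktuple.
Qed.

Lemma kernel0 : 0 \in kernel.
Proof. by rewrite unfold_in rmorph0. Qed.

Lemma kernelD p q : p \in kernel -> q \in kernel -> p + q \in kernel.
Proof.
by rewrite !unfold_in rmorphD => /eqP-> /eqP->; rewrite addr0.
Qed.

Lemma kernelM q p : p \in kernel -> q * p \in kernel.
Proof. by rewrite !unfold_in rmorphM => /eqP->; rewrite mulr0. Qed.

Definition gen S : {mpoly int[n]} := if [pick a | var_set a == S] is Some a then 'X_a else 0.

Lemma gen_var a : gen (var_set a) = 'X_a.
Proof.
rewrite /gen; case: pickP => [b /eqP/var_set_inj->//|/(_ a)].
by rewrite eqxx.
Qed.

Lemma gen_cases S : (exists2 a, var_set a = S & gen S = 'X_a) \/ gen S = 0.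
Proof.
rewrite /gen; case: pickP => [b /eqP<-|_]; last by right.
by left; exists b.
Qed.

Lemma gen_small S : (#|S| <= 2)%N -> gen S = 0.
Proof.
rewrite /gen; case: pickP => // b /eqP<-.
by rewrite leqNgt var_set_card.
Qed.

Lemma FY_ideal_atom (i : 'I_N) : #|flat_vertices i| = 2%N -> 'X_i \in @FY_ideal _ _ FB.
Proof.
by move=> i2; apply: ideal_span_gen; apply: FY_atom; rewrite flat_vertices_atom i2.
Qed.

Lemma gen_presentation (i : 'I_N) : presentation (gen (flat_vertices i)) = \pi_(FY FB) 'X_i.
Proof.
have [[a ai ->]|h0] := gen_cases (flat_vertices i).
  by rewrite /= lift_var (flat_vertices_inj ai).
have i2 : #|flat_vertices i| = 2%N.
  apply/eqP; rewrite eqn_leq flat_vertices_card andbT leqNgt; apply/negP => i2.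
  have [a ai] := var_set_surj (@flat_vertices_connected _ i) i2.
  by move: h0; rewrite -ai gen_var => /(congr1 (mcoeff U_(a)))/eqP; rewrite mcoeffX eqxx mcoeff0.
by rewrite h0 rmorph0; apply/esym/eqP; rewrite pi_FY_eq0; apply: FY_ideal_atom.
Qed.

Lemma gen_relation A B : connected_set A -> connected_set B -> (2 <= #|A|)%N -> (2 <= #|B|)%N ->
  A :&: B != set0 -> (gen (A :|: B) - gen A) * (gen (A :|: B) - gen B) \in kernel.
Proof.
move=> cA cB A2 B2 AB.
have [i iA] := flat_vertices_surj cA A2; have [j jB] := flat_vertices_surj cB B2.
have [k kU] : exists k, flat_vertices k = A :|: B.
  apply: flat_vertices_surj; first exact: connected_setU.
  exact: leq_trans A2 (subset_leq_card (subsetUl _ _)).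
rewrite unfold_in rmorphM !rmorphB -kU -iA -jB !gen_presentation -!rmorphB -rmorphM.
rewrite pi_FY_eq0.
by apply: FY_pair_relation; rewrite ?iA ?jB.
Qed.

Lemma presentation_surj (x : FY FB) : exists p, presentation p = x.
Proof.
pose has_preim (q : FY_poly FB) := exists p, presentation p = \pi_(FY FB) q.
suff : has_preim (repr x) by case=> p pE; exists p; rewrite pE reprK.
have pD q q' : has_preim q -> has_preim q' -> has_preim (q + q').
  by case=> p pE [p' pE']; exists (p + p'); rewrite !rmorphD pE pE'.
have pM q q' : has_preim q -> has_preim q' -> has_preim (q * q').
  by case=> p pE [p' pE']; exists (p * p'); rewrite !rmorphM pE pE'.
have p0 : has_preim 0 by exists 0; rewrite !rmorph0.
have p1 : has_preim 1 by exists 1; rewrite !rmorph1.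
have pX i k : has_preim ('X_i ^+ k).
  elim: k => [|k IH]; first by rewrite expr0.
  by rewrite exprS; apply: pM => //; exists (gen (flat_vertices i)); apply: gen_presentation.
rewrite [repr x]mpolyE; elim/big_ind: _ => // m _.
rewrite -mul_mpolyC; apply: (pM).
  by exists (mpolyC _ (mcoeff m (repr x))); rewrite -[mcoeff m _]intz !rmorph_int.
by rewrite mpolyXE_id; elim/big_ind: _.
Qed.

Lemma lift_monomial m : exists2 m', lift_poly 'X_[m] = 'X_[m'] &
  perm_eq (word (@flat_vertices G) m') (word var_set m).
Proof.
exists (\sum_(a < n) U_(var_index a) *+ m a)%MM.
  rewrite comp_mpolyX (big_morph _ (@mpolyXD _ _) (mpolyX0 _ _)).
  by apply: eq_bigr => a _; rewrite tnth_mktuple mpolyXn.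
apply/permP => P; rewrite !count_word.
under eq_bigr => i _ do rewrite mnm_sumE big_distrr /=.
rewrite exchange_big /=; apply: eq_bigr => a _.
rewrite (bigD1 (var_index a)) //= mulmnE mnm1E eqxx mul1n big1 ?addn0 // => i ia.
by rewrite mulmnE mnm1E eq_sym (negbTE ia) mul0n muln0.
Qed.

Lemma kernel_eval (phi : seq {set G} -> bool) p : FY_functional phi -> p \in kernel ->
  word_eval var_set phi p = 0.
Proof.
move=> phiF; rewrite kernelE => /(word_eval_FY_ideal phiF) <-.
rewrite comp_mpolyEX raddf_sum /= {1}/word_eval /mon_eval; apply: eq_bigr => m _.
rewrite /word_eval mon_evalZ; congr (_ * _).
have [m' -> wE] := lift_monomial m.
by rewrite mon_evalX; congr (nat_of_bool _)%:R; apply/esym/(functional_perm phiF).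
Qed.

End Presentation.

Section Homogeneous.

Lemma dhomog_prod_sum (n : nat) (R : comNzRingType) (I : Type) (s : seq I) (P : pred I)
    (d : I -> nat) (F : I -> {mpoly R[n]}) :
  (forall i, P i -> F i \is (d i).-homog) ->
  \prod_(i <- s | P i) F i \is (\sum_(i <- s | P i) d i)%N.-homog.
Proof.
move=> h; elim/big_rec2: _ => [|i k p Pi hp]; first exact: dhomog1.
by apply: dhomogM => //; apply: h.
Qed.

Variable G : sgraph.
Notation FB := (graph_building_set G).

Lemma FY_relation_homog (g : FY_poly FB) : FY_relation g -> exists d, g \is d.-homog.
Proof.
have X1 (i : 'I_#|FB|) : ('X_i : FY_poly FB) \is 1.-homog by rewrite dhomogX /= mdeg1.
case=> [i _|i A _ _]; first by exists 1%N.
exists (\sum_(j in A) 1)%N; apply: dhomog_prod_sum => j _.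
by apply: rpredB; apply: X1.
Qed.

Lemma FY_ideal_homogeneous k (p : FY_poly FB) : p \in @FY_ideal _ _ FB ->
  pihomog mdeg k p \in @FY_ideal _ _ FB.
Proof.
case/ideal_spanP=> s sS ->; rewrite raddf_sum big_seq.
apply: rpred_sum => x /sS xS; have [d gd] := FY_relation_homog xS.
rewrite [x.1]mpolyE mulr_suml raddf_sum; apply: rpred_sum => m _ /=.
have Xg : 'X_[m] * x.2 \is (mdeg m + d)%N.-homog by apply: dhomogM => //; rewrite dhomogX.
rewrite -scalerAl linearZ /= -mul_mpolyC; apply: idealMr.
have [e|ne] := eqVneq (mdeg m + d)%N k; last by rewrite (pihomog_ne0 ne Xg) rpred0.
rewrite e in Xg; rewrite pihomog_dE //; apply: idealMr; exact: ideal_span_gen.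
Qed.

Lemma pihomog_comp_mpoly (n N : nat) (R : comNzRingType) (lq : n.-tuple {mpoly R[N]}) k p :
  (forall i, tnth lq i \is 1.-homog) ->
  pihomog mdeg k (p \mPo lq) = pihomog mdeg k p \mPo lq.
Proof.
move=> lq1; have -> : pihomog mdeg k p = \sum_(m <- msupp p) p@_m *: pihomog mdeg k 'X_[m].
  by rewrite {1}[p]mpolyE raddf_sum /=; apply: eq_bigr => m _; rewrite linearZ.
rewrite comp_mpolyEX !raddf_sum /=; apply: eq_bigr => m _.
rewrite linearZ /= comp_mpolyZ pihomogX; congr (_ *: _).
have Xh : 'X_[m] \mPo lq \is (mdeg m).-homog.
  rewrite comp_mpolyX mdegE; apply: dhomog_prod_sum => i _.
  by have := dhomogMn (m i) (lq1 i); rewrite mul1n.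
have [e|ne] := eqVneq (mdeg m) k; last by rewrite (pihomog_ne0 ne Xh) comp_mpoly0.
by rewrite pihomog_dE // -e.
Qed.

End Homogeneous.

Theorem corollary4p3 (G : sgraph) (chordal_G : chordal G) :
  @admits_quadratic_GB (FY (graph_building_set G))
    (@FY_weight _ _ (graph_building_set G)).
Proof.
have [r elim_r] := elimination_order_exists chordal_G; have r_inj := proj1 elim_r.
exists (size (variables r)), (presentation r); split.
- move=> a; exists 'X_(var_index a); first by rewrite dhomogX /= mdeg1.
  by rewrite /= lift_var.
- exact: presentation_surj.
- move=> p; rewrite -[p \in _]/(p \in @kernel G r) kernelE => pI k.
  rewrite -[_ \in _]/(pihomog mdeg k p \in @kernel G r) kernelE -pihomog_comp_mpoly.
    exact: FY_ideal_homogeneous.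
  by move=> i; rewrite tnth_mktuple dhomogX /= mdeg1.
pose bad := non_standard r (@var_set G r).
have rule a b (ns : bad a b) : exists g, rewriting_rule (@kernel G r) a b g :=
  rewriting_rule_exists elim_r (@var_set_inj G r) (@var_set_card G r)
    (@var_set_connected G r) (@var_order G r) (@gen_var G r) (@gen_cases G r)
    (@gen_small G r) (@kernelD G r) (@kernelM G r) (@gen_relation G r) ns.
have free := standard_monomials_free r_inj (@var_set_inj G r) (@var_set_card G r)
  (@kernel_eval G r).
have /choice[g gP] (ab : 'I_(size (variables r)) * 'I_(size (variables r))) :
    exists g, bad ab.1 ab.2 -> rewriting_rule (@kernel G r) ab.1 ab.2 g.
  by have [/rule[g gab]|_] := boolP (bad ab.1 ab.2); [exists g|exists 0].
pose g' a b := g (a, b).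
have gK a b : bad a b -> g' a b \in @kernel G r by case/(gP (a, b)).
have g_lead a b : bad a b -> below (U_(a) + U_(b)) (g' a b - 'X_a * 'X_b).
  by case/(gP (a, b)).
exists (@mon_le _), (quadratic_basis bad g'); split.
- exact: monomial_order_mon_le.
- exact: (quadratic_basis_groebner (@kernel0 G r) (@kernelD G r) (@kernelM G r) gK g_lead free).
- by move=> q /quadratic_basisP[a [b [/(gP (a, b))[_ gh _] ->]]].
Qed.
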